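(* Consider the sparse normal means model: one observes $X=(X_1,\ldots,X_n)$ with $X_i=\theta_i+\varepsilon_i$, $\varepsilon_i$ i.i.d. $\mathcal{N}(0,1)$, with $P_\theta,E_\theta$ the law of $X$ and expectation under $\theta$, $\ell_0[s_n]=\{\theta\in\mathbb{R}^n:\#\{i:\theta_i\ne0\}\le s_n\}$, and $r_n=2s_n\log(n/s_n)$. Let $\Pi_\alpha=\bigotimes_{i=1}^n((1-\alpha)\delta_0+\alpha G)$ with $G$ the standard Cauchy distribution (density $\gamma(x)=\frac1{\pi(1+x^2)}$), and let $\hat\alpha$ maximise over $[\alpha_n,1]$ the log-marginal likelihood $\ell_n(\alpha)=\sum_{i=1}^n\log((1-\alpha)\phi(X_i)+\alpha g(X_i))$, with $\phi$ the standard normal density, $g=\phi*\gamma$, $t(\alpha_n)=\sqrt{2\log n}$. For $n\ge3$ and $A\ge0$ set $t_n^2=2\log n-5\log\log n$, $t_A=\sqrt{2(1+A)\log n}$, $\hat t=t(\hat\alpha)$, $\alpha_A=t^{-1}(t_A)$, and define the modified estimator $\hat\alpha_A=\hat\alpha$ if $\hat t\le t_n$ and $\hat\alpha_A=\alpha_A$ if $\hat t>t_n$. Fix $A>0$. Then there exist $C,c_0>0$ and $N_0>0$ such that for any $n\ge N_0$ and any $s_n$ with $1\le s_n\le c_0n$, \[ \sup_{\theta_0\in\ell_0[s_n]}E_{\theta_0}\int\|\theta-\theta_0\|^2\,d\Pi_{\hat\alpha_A}(\theta\mid X)\le Cr_n. \]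
   Context: For fixed $\alpha$, the posterior is $\Pi_\alpha[\cdot\mid X]=\bigotimes_{i=1}^n((1-a(X_i))\delta_0+a(X_i)G_{X_i})$ with $a(x)=\frac{\alpha g(x)}{(1-\alpha)\phi(x)+\alpha g(x)}$ and $G_x$ of density $\gamma_x(u)=\phi(x-u)\gamma(u)/g(x)$; $\Pi_{\hat\alpha_A}[\cdot\mid X]$ is this with $\alpha=\hat\alpha_A$. The threshold $t(\alpha)>0$ is the posterior median threshold for fixed $\alpha$: the coordinatewise posterior median of $\theta_i$ is $0$ iff $|X_i|\le t(\alpha)$; $t(\cdot)$ is continuous and strictly decreasing, hence invertible. $\|\cdot\|$ is the Euclidean norm. *)

(* Defs.v *)
From HB Require Import structures.
From mathcomp Require Import all_boot all_order all_algebra.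
From mathcomp Require Import all_classical all_reals all_analysis.
Set Implicit Arguments. Unset Strict Implicit. Unset Printing Implicit Defensive.
Import Order.TTheory GRing.Theory Num.Theory.
Import numFieldNormedType.Exports.
Local Open Scope classical_set_scope.
Local Open Scope ring_scope.

Section SparseNormalMeans.
Variable R : realType.
Local Notation leb := (@lebesgue_measure R).

Definition phi (x : R) : R := expR (- (x ^+ 2) / 2) / Num.sqrt (2 * pi).
Definition gam (u : R) : R := 1 / (pi * (1 + u ^+ 2)).
Definition gconv (x : R) : R :=
  fine (\int[leb]_(u in [set: R]) (phi (x - u) * gam u)%:E)%E.
Definition apost (alpha x : R) : R :=
  alpha * gconv x / ((1 - alpha) * phi x + alpha * gconv x).
Definition gamx (x u : R) : R := phi (x - u) * gam u / gconv x.
Definition Gx (x : R) (B : set R) : R :=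
  fine (\int[leb]_(u in B) (gamx x u)%:E)%E.

(* 0 is a (coordinatewise) posterior median of (1-a)delta_0 + a G_x:
   posterior mass of (-oo,0) and of (0,+oo) are both at most 1/2 *)
Definition median_is0 (alpha x : R) : Prop :=
  apost alpha x * Gx x `]-oo, 0[ <= 2^-1 /\
  apost alpha x * Gx x `]0, +oo[ <= 2^-1.

(* posterior median threshold t(alpha): median is 0 iff |x| <= t(alpha) *)
Definition tthr (alpha : R) : R := sup [set x : R | 0 <= x /\ median_is0 alpha x].
Definition tinv (y : R) : R := xget 0 [set a : R | 0 < a < 1 /\ tthr a = y].

Definition loglik (n : nat) (alpha : R) (X : nat -> R) : R :=
  \sum_(i < n) ln ((1 - alpha) * phi (X i) + alpha * gconv (X i)).

Definition alpha_n (n : nat) : R := tinv (Num.sqrt (2 * ln n%:R)).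

Definition is_mle (n : nat) (ahat : (nat -> R) -> R) : Prop :=
  forall X : nat -> R, alpha_n n <= ahat X <= 1 /\
    forall b, alpha_n n <= b <= 1 -> loglik n b X <= loglik n (ahat X) X.

Definition t_n (n : nat) : R :=
  Num.sqrt (2 * ln n%:R - 5 * ln (ln n%:R)).
Definition t_A (A : R) (n : nat) : R := Num.sqrt (2 * (1 + A) * ln n%:R).
Definition alpha_A (A : R) (n : nat) : R := tinv (t_A A n).

Definition ahat_A (A : R) (n : nat) (ahat : (nat -> R) -> R) (X : nat -> R) : R :=
  if tthr (ahat X) <= t_n n then ahat X else alpha_A A n.

Definition upd (x : nat -> R) (k : nat) (u : R) : nat -> R :=
  fun j => if j == k then u else x j.

(* iterated integral over coordinates 0..k-1 against the product of the
   one-dimensional integration functionals mu i (other coordinates = 0) *)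
Fixpoint iterint (mu : nat -> (R -> \bar R) -> \bar R) (k : nat)
    (F : (nat -> R) -> \bar R) : \bar R :=
  match k with
  | 0 => F (fun _ => 0)
  | k'.+1 => iterint mu k' (fun x => mu k' (fun u => F (upd x k' u)))
  end.

(* integral against the i-th factor (1-a(X_i)) delta_0 + a(X_i) G_{X_i}
   of the posterior Pi_alpha[. | X] *)
Definition post_coord (alpha : R) (X : nat -> R) (i : nat) (f : R -> \bar R)
  : \bar R :=
  ((1 - apost alpha (X i))%:E * f 0%R +
   (apost alpha (X i))%:E * \int[leb]_(u in [set: R]) (f u * (gamx (X i) u)%:E))%E.

(* integral against the i-th factor N(theta0_i, 1) of P_theta0 *)
Definition data_coord (theta0 : nat -> R) (i : nat) (f : R -> \bar R) : \bar R :=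
  (\int[leb]_(x in [set: R]) (f x * (phi (x - theta0 i))%:E))%E.

Definition post_risk (n : nat) (alpha : R) (X theta0 : nat -> R) : \bar R :=
  iterint (post_coord alpha X) n
    (fun theta => (\sum_(i < n) (theta i - theta0 i) ^+ 2)%:E).

Definition risk (A : R) (n : nat) (ahat : (nat -> R) -> R) (theta0 : nat -> R)
  : \bar R :=
  iterint (data_coord theta0) n
    (fun X => post_risk n (ahat_A A n ahat X) X theta0).

(* theta0 in l0[s] (only coordinates 0..n-1 are meaningful) *)
Definition in_l0 (n : nat) (s : R) (theta0 : nat -> R) : Prop :=
  (#|[set i : 'I_n | theta0 i != 0]|)%:R <= s.

Definition r_n (n : nat) (s : R) : R := 2 * s * ln (n%:R / s).

End SparseNormalMeans.

(* Main.v *)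
Require Import Defs.
From HB Require Import structures.
From mathcomp Require Import all_boot all_order all_algebra.
From mathcomp Require Import all_classical all_reals all_analysis.
From mathcomp Require Import measurable_realfun ring lra.
Set Implicit Arguments. Unset Strict Implicit. Unset Printing Implicit Defensive.
Import Order.TTheory GRing.Theory Num.Theory.
Import numFieldNormedType.Exports.
Local Open Scope classical_set_scope.
Local Open Scope ring_scope.

(** The data law and the posterior are products, so an iterated integral of a sum
    of products of one-coordinate functions is explicit; every random quantity is
    therefore bounded pathwise by such a sum before integrating, which also
    disposes of the non-measurability of the estimator.

    Write B(x, a) = (g - phi)(x) / ((1 - a) phi(x) + a g(x)) for the score of one
    observation. By concavity of the log-likelihood, ahat > a forces
    sum_i B(X_i, a) >= 0, and ahat < b forces sum_i B(X_i, b) <= 0.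

    Signals: up to (X_i - theta_i)^2 the loss of a nonzero coordinate is the
    posterior mass of 0 times X_i^2, and this is at most a constant times
    ln (K (B(X_i, b) + K)) as soon as ln (1/alpha) = O(1 + ln (1/b)). Since
    sum_i B(X_i, b) <= 0, concavity of ln bounds the sum over the at most s signals
    by O(s ln (n/s)), with no probability involved. One takes b = min(1, 2 ahat)
    when alpha = ahat, and b = n^(-1/8) when alpha = alpha_A.

    Zero coordinates: the loss is at most a constant times a(X_i) (1 + X_i^2), of mean
    O(alpha z + exp (- z^2 / 4)) for every z >= 0. This is enough for alpha = alpha_A,
    which is O(n^(-1-A) ln n), and for alpha <= a_s, with a_s of order
    (s/n) sqrt (ln (n/s)). Otherwise ahat exceeds both a_s and a constant times
    (ln n)^2 / n, because t(ahat) <= t_n forces ahat to be at least of order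
    (ln n)^(5/2) / n; then the score at the larger of these two values is nonnegative,
    and a Chernoff bound shows that this has probability O(1/n) even after weighting
    by 1 + X_i^2. *)

(** * Iterated integrals of sums of products *)

Section IteratedIntegrals.
Context {R : realType}.
Implicit Types (mu : (R -> \bar R) -> \bar R) (nu : nat -> (R -> \bar R) -> \bar R).

(* The integral of a nonnegative non-measurable function is a lower integral: it is
   still monotone, but no longer additive. *)
Definition positive_functional mu :=
  [/\ forall f, (forall x, 0 <= f x)%E -> (0 <= mu f)%E,
      forall f g, (forall x, 0 <= f x)%E -> (forall x, f x <= g x)%E ->
        (mu f <= mu g)%E &
      forall (I : Type) (l : seq I) (c : I -> R) (f : I -> R -> R),
        (forall t, 0 <= c t) -> (forall t x, 0 <= f t x) ->
        (forall t, measurable_fun [set: R] (f t)) ->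
        mu (fun x => (\sum_(t <- l) c t * f t x)%:E) =
        (\sum_(t <- l) (c t)%:E * mu (EFin \o f t))%E].

Lemma iterint_ge0 nu n F : (forall i, positive_functional (nu i)) ->
  (forall X, 0 <= F X)%E -> (0 <= iterint nu n F)%E.
Proof.
move=> nuP; elim: n F => [|n IH] F F0 /=; first exact: F0.
by apply: IH => X; have [+ _ _] := nuP n; apply.
Qed.

Lemma le_iterint nu n F G : (forall i, positive_functional (nu i)) ->
  (forall X, 0 <= F X)%E -> (forall X, F X <= G X)%E ->
  (iterint nu n F <= iterint nu n G)%E.
Proof.
move=> nuP; elim: n F G => [|n IH] F G F0 FG /=; first exact: FG.
apply: IH => X; first by have [+ _ _] := nuP n; apply.
by have [_ + _] := nuP n; apply.
Qed.

(** The innermost integral acts on coordinate [n] with the others frozen, so the additivity clause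
    applies to it. The bound [m t n] is absorbed into the coefficient, which is why [c] is general
    in the induction. *)
Lemma iterint_sum_prod nu n (I : Type) (l : seq I) (c : I -> R)
    (f : I -> nat -> R -> R) (m : I -> nat -> R) :
  (forall i, positive_functional (nu i)) ->
  (forall t, 0 <= c t) -> (forall t i x, 0 <= f t i x) ->
  (forall t i, measurable_fun [set: R] (f t i)) ->
  (forall t i, nu i (EFin \o f t i) <= (m t i)%:E)%E ->
  (iterint nu n (fun X => (\sum_(t <- l) c t * \prod_(i < n) f t i (X i))%:E) <=
   (\sum_(t <- l) c t * \prod_(i < n) m t i)%:E)%E.
Proof.
move=> nuP c0 f0 mf mm.
have m0 t i : 0 <= m t i.
  rewrite -lee_fin (le_trans _ (mm t i))//.
  by have [+ _ _] := nuP i; apply => x; rewrite lee_fin.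
elim: n c c0 => [|n IH] c c0 /=.
  by rewrite lee_fin; apply: ler_sum => t _; rewrite !big_ord0.
have [nu0 numono nulin] := nuP n.
apply: (@le_trans _ _ (iterint nu n
  (fun X => (\sum_(t <- l) (c t * m t n) * \prod_(i < n) f t i (X i))%:E))).
  apply: le_iterint => // X.
    apply: nu0 => u; rewrite lee_fin; apply: sumr_ge0 => t _.
    by rewrite mulr_ge0// prodr_ge0.
  rewrite (_ : (fun u => _) =
     (fun u => (\sum_(t <- l) (c t * \prod_(i < n) f t i (X i)) * f t n u)%:E)).
    rewrite nulin//; last by move=> t; rewrite mulr_ge0// prodr_ge0.
    rewrite -sumEFin; apply: lee_sum => t _.
    rewrite mulrAC [leRHS]EFinM lee_wpmul2l//.
    by rewrite lee_fin mulr_ge0// prodr_ge0.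
  apply/funext => u; congr EFin; apply: eq_bigr => t _.
  rewrite big_ord_recr/= /upd eqxx mulrA; congr (_ * _ * _).
  by apply: eq_bigr => i _; rewrite ltn_eqF.
apply: (le_trans (IH _ _)) => [t|]; first by rewrite mulr_ge0.
by rewrite lee_fin; apply: ler_sum => t _; rewrite big_ord_recr/= mulrAC mulrA.
Qed.

(* H is dominated by sum_t c t * prod_i f t i (X i), whose iterated integral is at
   most sum_t c t * prod_i m t i <= M. *)
Definition sum_prod_bound nu n (H : (nat -> R) -> R) (M : R) : Prop :=
  exists (I : Type) (l : seq I) (c : I -> R) (f : I -> nat -> R -> R)
    (m : I -> nat -> R),
  [/\ forall t, 0 <= c t, forall t i x, 0 <= f t i x,
      forall t i, measurable_fun [set: R] (f t i),
      forall t i, (nu i (EFin \o f t i) <= (m t i)%:E)%E &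
      (forall X, H X <= \sum_(t <- l) c t * \prod_(i < n) f t i (X i)) /\
      \sum_(t <- l) c t * \prod_(i < n) m t i <= M].

(** Only monotonicity is applied to [F]; additivity is used for the measurable dominating sum alone.
    Hence [F] may involve a non-measurable estimator. *)
Lemma le_iterint_bound nu n F H M : (forall i, positive_functional (nu i)) ->
  (forall X, 0 <= F X)%E -> (forall X, F X <= (H X)%:E)%E ->
  sum_prod_bound nu n H M -> (iterint nu n F <= M%:E)%E.
Proof.
move=> nuP F0 FH [I [l [c [f [m [c0 f0 mf mm [Hl lM]]]]]]].
apply: (@le_trans _ _ (\sum_(t <- l) c t * \prod_(i < n) m t i)%:E).
  apply: (le_trans _ (iterint_sum_prod n l nuP c0 f0 mf mm)).
  by apply: le_iterint => // X; rewrite (le_trans (FH X))// lee_fin.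
by rewrite lee_fin.
Qed.

Lemma sum_prod_boundD nu n H1 H2 M1 M2 :
  sum_prod_bound nu n H1 M1 -> sum_prod_bound nu n H2 M2 ->
  sum_prod_bound nu n (fun X => H1 X + H2 X) (M1 + M2).
Proof.
move=> [I [l [c [f [m [c0 f0 mf mm [Hl lM]]]]]]].
move=> [I' [l' [c' [f' [m' [c'0 f'0 mf' mm' [Hl' lM']]]]]]].
exists (I + I')%type, (map inl l ++ map inr l'),
  (fun t => match t with inl t => c t | inr t => c' t end),
  (fun t => match t with inl t => f t | inr t => f' t end),
  (fun t => match t with inl t => m t | inr t => m' t end).
split; [by case|by case|by case|by case|split].
  by move=> X; rewrite big_cat/= !big_map; apply: lerD.
by rewrite big_cat/= !big_map; apply: lerD.
Qed.

Lemma sum_prod_bound_le nu n H H' M M' : (forall X, H' X <= H X) -> M <= M' ->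
  sum_prod_bound nu n H M -> sum_prod_bound nu n H' M'.
Proof.
move=> HH MM [I [l [c [f [m [c0 f0 mf mm [Hl lM]]]]]]].
exists I, l, c, f, m; split=> //; split.
  by move=> X; rewrite (le_trans (HH X)).
exact: le_trans MM.
Qed.

Lemma sum_prod_boundZ nu n k H M : 0 <= k ->
  sum_prod_bound nu n H M -> sum_prod_bound nu n (fun X => k * H X) (k * M).
Proof.
move=> k0 [I [l [c [f [m [c0 f0 mf mm [Hl lM]]]]]]].
exists I, l, (fun t => k * c t), f, m; split=> // [t|]; first exact: mulr_ge0.
by split=> [X|]; under eq_bigr do rewrite -mulrA; rewrite -mulr_sumr ler_wpM2l.
Qed.

Lemma sum_prod_bound_prod nu n (f : nat -> R -> R) (m : nat -> R) c :
  0 <= c -> (forall i x, 0 <= f i x) -> (forall i, measurable_fun [set: R] (f i)) ->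
  (forall i, nu i (EFin \o f i) <= (m i)%:E)%E ->
  sum_prod_bound nu n (fun X => c * \prod_(i < n) f i (X i))
    (c * \prod_(i < n) m i).
Proof.
move=> c0 f0 mf mm.
exists unit, [:: tt], (fun=> c), (fun=> f), (fun=> m); split => //; split.
  by move=> X; rewrite big_seq1.
by rewrite big_seq1.
Qed.

Lemma sum_prod_bound_cst nu n c : 0 <= c ->
  (forall i, nu i (fun=> 1) <= 1)%E -> sum_prod_bound nu n (fun=> c) c.
Proof.
move=> c0 nu1.
have := @sum_prod_bound_prod nu n (fun _ => cst 1) (fun=> 1) c c0.
move=> /(_ (fun=> fun=> ler01) (fun=> @measurable_cst _ _ _ _ _ _) nu1).
by apply: sum_prod_bound_le => [X|]; rewrite /= big1_eq mulr1.
Qed.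

Lemma sum_prod_bound_sum nu n k (H : 'I_k -> (nat -> R) -> R) (M : 'I_k -> R) :
  (forall j, sum_prod_bound nu n (H j) (M j)) ->
  sum_prod_bound nu n (fun X => \sum_j H j X) (\sum_j M j).
Proof.
elim: k H M => [|k IH] H M HM.
  exists void, [::], (fun=> 0), (fun=> fun=> cst 0), (fun=> fun=> 0).
  by split=> //; split=> [X|]; rewrite big_ord0 big_nil.
rewrite big_ord_recl.
apply: (sum_prod_bound_le _ (lexx _) (sum_prod_boundD (HM ord0) (IH _ _ (fun j => HM (lift ord0 j))))).
by move=> X; rewrite big_ord_recl.
Qed.

(** A function of one coordinate is a product whose other factors are 1, and each of these
    integrates to at most 1. *)
Lemma sum_prod_bound1 nu n (j : 'I_n) (f : R -> R) m :
  (forall i, nu i (fun=> 1) <= 1)%E -> (forall x, 0 <= f x) ->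
  measurable_fun [set: R] f -> (nu j (EFin \o f) <= m%:E)%E ->
  sum_prod_bound nu n (fun X => f (X j)) m.
Proof.
move=> nu1 f0 mf fm.
pose g i := if i == j :> nat then f else cst 1.
pose mm i := if i == j :> nat then m else 1.
have g0 i x : 0 <= g i x by rewrite /g; case: ifP.
have mg i : measurable_fun [set: R] (g i) by rewrite /g; case: ifP.
have gm i : (nu i (EFin \o g i) <= (mm i)%:E)%E.
  by rewrite /g /mm; case: eqP => [->|_]//; exact: nu1.
apply: sum_prod_bound_le (sum_prod_bound_prod n ler01 g0 mg gm).
- move=> X; rewrite mul1r (bigD1 j)//= /g eqxx big1 ?mulr1// => i ij.
  by rewrite ifN.
- rewrite mul1r (bigD1 j)//= /mm eqxx big1 ?mulr1// => i ij.
  by rewrite ifN.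
Qed.

End IteratedIntegrals.

(** * Monotonicity and lower bounds for Lebesgue integrals *)

Section LebesgueFunctionals.
Context {R : realType}.
Local Notation leb := (@lebesgue_measure R).
Implicit Types (x u t : R).

(** The integral of a nonnegative function is a supremum over the simple functions below it, so
    monotonicity holds without measurability. *)
Lemma le_integral_ge0 (f g : R -> \bar R) : (forall x, 0 <= f x)%E ->
  (forall x, f x <= g x)%E -> (\int[leb]_x f x <= \int[leb]_x g x)%E.
Proof.
move=> f0 fg; rewrite !ge0_integralTE//; last first.
  by move=> x; exact: le_trans (fg x).
apply: le_ereal_sup => _ /= [h hf <-]; exists h => // x.
exact: le_trans (fg x).
Qed.

Lemma integral_weight_positive (w : R -> R) : (forall x, 0 <= w x) ->
  measurable_fun [set: R] w ->
  positive_functional (fun f => \int[leb]_x (f x * (w x)%:E))%E.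
Proof.
move=> w0 mw; split.
- by move=> f f0; apply: integral_ge0 => x _; rewrite mule_ge0// lee_fin.
- move=> f g f0 fg; apply: le_integral_ge0 => x.
    by rewrite mule_ge0// lee_fin.
  by rewrite lee_wpmul2r// lee_fin.
- move=> I l c f c0 f0 mf.
  under eq_integral do rewrite -EFinM mulr_suml -sumEFin.
  rewrite ge0_integral_sum//; last 2 first.
    move=> t; apply/measurable_EFinP; apply: measurable_funM => //.
    by apply: measurable_funM => //; exact: mf.
    by move=> t x _; rewrite lee_fin !mulr_ge0.
  apply: eq_bigr => t _.
  under eq_integral do rewrite -mulrA EFinM.
  rewrite ge0_integralZl_EFin//.
  + by move=> x _; rewrite lee_fin mulr_ge0.
  + by apply/measurable_EFinP; apply: measurable_funM => //; exact: mf.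
Qed.

Lemma le_integral_interval (D : set R) (f : R -> R) (a b c : R) : a <= b -> 0 <= c ->
  measurable D -> `[a, b] `<=` D -> (forall x, 0 <= f x) ->
  measurable_fun [set: R] f -> (forall x, a <= x <= b -> c <= f x) ->
  ((c * (b - a))%:E <= \int[leb]_(x in D) (f x)%:E)%E.
Proof.
move=> ab c0 mD abD f0 mf cf.
apply: (@le_trans _ _ (\int[leb]_(x in `[a, b]) (f x)%:E)%E); last first.
  apply: ge0_subset_integral => //.
  - by apply/measurable_EFinP; exact: measurable_funTS.
  - by move=> x _; rewrite lee_fin.
apply: (@le_trans _ _ (\int[leb]_(x in `[a, b]) (cst c%:E) x)%E).
  rewrite integral_cst//= lebesgue_measure_itv/= lte_fin.
  case: ltP => // ba.
  by rewrite (_ : b - a = 0) ?mulr0 ?mule0//; apply/eqP; rewrite subr_eq0 eq_le ba ab.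
apply: ge0_le_integral => //.
by apply/measurable_EFinP; exact: measurable_funTS.
Qed.

End LebesgueFunctionals.

(** * The Gaussian and Cauchy densities and their convolution *)

Section Densities.
Context {R : realType}.
Local Notation leb := (@lebesgue_measure R).
Local Notation phi := (@phi R).
Local Notation gam := (@gam R).
Local Notation gconv := (@gconv R).
Implicit Types (x u t w : R).

Lemma sqrt2pi_ge1 : 1 <= Num.sqrt (2 * pi) :> R.
Proof.
rewrite -[leLHS]sqrtr1 ler_sqrt//; last by rewrite mulr_ge0// pi_ge0.
by have := @pi_ge2 R; lra.
Qed.

Lemma phi_gt0 x : 0 < phi x.
Proof.
by rewrite /phi divr_gt0 ?expR_gt0// (lt_le_trans _ sqrt2pi_ge1).
Qed.

Lemma phi_ge0 x : 0 <= phi x. Proof. exact/ltW/phi_gt0. Qed.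

Lemma phiN x : phi (- x) = phi x. Proof. by rewrite /phi sqrrN. Qed.

Lemma phi_le_expR x : phi x <= expR (- (x ^+ 2) / 2).
Proof.
by rewrite /phi ler_pdivrMr ?ler_peMr ?expR_ge0 ?sqrt2pi_ge1// (lt_le_trans _ sqrt2pi_ge1).
Qed.

Lemma le_phi x u : u ^+ 2 <= x ^+ 2 -> phi x <= phi u.
Proof.
move=> ux; rewrite /phi ler_pM2r ?invr_gt0 ?(lt_le_trans _ sqrt2pi_ge1)//.
by rewrite ler_expR; lra.
Qed.

Lemma gam_gt0 u : 0 < gam u.
Proof. by rewrite /gam divr_gt0// mulr_gt0 ?pi_gt0// ltr_pwDl// sqr_ge0. Qed.

Lemma gam_ge0 u : 0 <= gam u. Proof. exact/ltW/gam_gt0. Qed.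

Lemma gamN u : gam (- u) = gam u. Proof. by rewrite /gam sqrrN. Qed.

Lemma continuous_phi : continuous phi.
Proof.
move=> x; rewrite /phi; apply: cvgMr_tmp.
apply: continuous_comp; last exact: continuous_expR.
by apply: cvgMr_tmp; apply: cvgN; exact: exprn_continuous.
Qed.

Lemma continuous_gam : continuous gam.
Proof.
move=> x; rewrite /gam; under eq_fun do rewrite div1r.
apply: cvgV; first by rewrite gt_eqF// mulr_gt0 ?pi_gt0// ltr_pwDl// sqr_ge0.
by apply: cvgMl_tmp; exact: continuous_oneDsqr.
Qed.

Lemma measurable_phi : measurable_fun [set: R] phi.
Proof. exact: continuous_measurable_fun continuous_phi. Qed.

Lemma measurable_gam : measurable_fun [set: R] gam.
Proof. exact: continuous_measurable_fun continuous_gam. Qed.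

Lemma phi_normal m x : phi (x - m) = normal_pdf m 1 x.
Proof.
rewrite normal_pdfE ?oner_neq0// /phi /normal_peak /normal_fun.
by rewrite expr1n mul1r mulrC mulr_natl.
Qed.

Lemma integral_phi m : (\int[leb]_x (phi (x - m))%:E = 1)%E.
Proof.
by under eq_integral do rewrite phi_normal; rewrite integral_normal_pdf.
Qed.

Lemma measurable_phi_shift m : measurable_fun [set: R] (fun x => phi (x - m)).
Proof. by apply: measurableT_comp measurable_phi _; exact: measurable_funB. Qed.

(** Proportional to the density of N(0, 4): its integral is known, and it decays slowly enough to
    dominate [phi] times a polynomial. *)
Definition bell x : R := expR (- (x ^+ 2) / 8).

Lemma continuous_bell : continuous bell.
Proof.
move=> x; apply: continuous_comp; last exact: continuous_expR.
by apply: cvgMr_tmp; apply: cvgN; exact: exprn_continuous.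
Qed.

Lemma measurable_bell m : measurable_fun [set: R] (fun x => bell (x - m)).
Proof.
apply: measurableT_comp (continuous_measurable_fun continuous_bell) _.
exact: measurable_funB.
Qed.

Lemma integral_bell m : (\int[leb]_x (bell (x - m))%:E = (Num.sqrt (8 * pi))%:E)%E.
Proof.
have p0 : 0 < Num.sqrt (8 * pi) :> R by rewrite sqrtr_gt0 mulr_gt0// pi_gt0.
have E x : bell (x - m) = Num.sqrt (8 * pi) * normal_pdf m 2 x.
  rewrite normal_pdfE// /normal_peak /normal_fun /bell.
  have -> : 2 ^+ 2 * pi *+ 2 = 8 * pi :> R by ring.
  have -> : 2 ^+ 2 *+ 2 = 8 :> R by ring.
  by rewrite mulrA divff ?gt_eqF// mul1r.
under eq_integral do rewrite E EFinM.
rewrite ge0_integralZl_EFin//.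
- by rewrite integral_normal_pdf mule1.
- by move=> x _; rewrite lee_fin normal_pdf_ge0.
- by apply/measurable_EFinP; exact: measurable_normal_pdf.
Qed.

(** With y = w^2, 1 + y <= 16 exp(y/16); squaring costs exp(y/8), and y/8 - y/2 <= - y/8. *)
Lemma poly_phi_le_bell w : (1 + w ^+ 2) ^+ 2 * phi w <= 16 ^+ 2 * bell w.
Proof.
apply: (@le_trans _ _ ((1 + w ^+ 2) ^+ 2 * expR (- (w ^+ 2) / 2))).
  by rewrite ler_wpM2l ?sqr_ge0// phi_le_expR.
have y0 : 0 <= w ^+ 2 := sqr_ge0 w; rewrite /bell; set y := w ^+ 2 in y0 *.
have e1 : 1 + y <= 16 * expR (y / 16).
  by have := expR_ge1Dx (y / 16); lra.
have e2 : (1 + y) ^+ 2 <= 16 ^+ 2 * expR (y / 8).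
  have -> : 16 ^+ 2 * expR (y / 8) = (16 * expR (y / 16)) ^+ 2.
    by rewrite exprMn -expRM_natl; congr (_ * expR _); field.
  by rewrite lerXn2r// nnegrE ?mulr_ge0 ?expR_ge0//; lra.
apply: (@le_trans _ _ (16 ^+ 2 * expR (y / 8) * expR (- y / 2))).
  by rewrite ler_wpM2r ?expR_ge0.
rewrite -mulrA ler_pM2l// -expRD ler_expR; lra.
Qed.

Lemma integral_gam : (\int[leb]_x (gam x)%:E = 1)%E.
Proof.
have pi0 := @pi_gt0 R.
rewrite (ge0_symfun_integralT gam_ge0 continuous_gam); last first.
  by move=> x; rewrite /= gamN.
have -> : [set x : R | 0 <= x] = `[0, +oo[%classic.
  by apply/seteqP; split => x/=; rewrite in_itv/= andbT.
have E x : gam x = pi^-1 * (oneDsqr x)^-1.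
  by rewrite /gam /oneDsqr div1r invfM.
under eq_integral do rewrite E EFinM.
rewrite ge0_integralZl_EFin//.
- rewrite integral0y_oneDsqr -!EFinM. congr EFin.
  by rewrite mulrCA [2 * _]mulrC divfK// mulVf// gt_eqF.
- apply/measurable_EFinP; apply: measurable_funTS.
  apply: continuous_measurable_fun; exact: continuous_oneDsqrV.
- by rewrite invr_ge0 ltW.
Qed.

(** Peetre's inequality 1 + x^2 <= 2 (1 + u^2) (1 + (u - x)^2): moving the heavy-tailed prior from u
    to x costs only a polynomial in u - x, which the Gaussian factor can pay for. *)
Lemma gam_le x u : gam u <= 2 * (1 + (u - x) ^+ 2) / (1 + x ^+ 2).
Proof.
have pi2 := @pi_ge2 R.
have dx : 0 < 1 + x ^+ 2 by rewrite ltr_pwDl ?sqr_ge0.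
have du : 0 < 1 + u ^+ 2 by rewrite ltr_pwDl ?sqr_ge0.
rewrite /gam ler_pdivlMr// mulrAC ler_pdivrMr; last by rewrite mulr_gt0//; lra.
rewrite mul1r; apply: (@le_trans _ _ (2 * (1 + (u - x) ^+ 2) * (1 + u ^+ 2))).
  by have := sqr_ge0 (2 * u - x); have := sqr_ge0 ((u - x) * u); nra.
rewrite ler_wpM2l ?mulr_ge0 ?addr_ge0 ?sqr_ge0// ler_peMl//; lra.
Qed.

Lemma weight_gconv_le x u : (1 + (u - x) ^+ 2) * (phi (x - u) * gam u) <=
  (2 * 16 ^+ 2) / (1 + x ^+ 2) * bell (u - x).
Proof.
have dx : 0 < 1 + x ^+ 2 by rewrite ltr_pwDl ?sqr_ge0.
have du : 0 < 1 + (u - x) ^+ 2 by rewrite ltr_pwDl ?sqr_ge0.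
rewrite -[x - u]opprB phiN.
apply: (@le_trans _ _ ((1 + (u - x) ^+ 2) * (phi (u - x) * (2 * (1 + (u - x) ^+ 2) / (1 + x ^+ 2))))).
  apply: ler_wpM2l; first exact: ltW.
  by rewrite ler_pM2l ?phi_gt0// gam_le.
rewrite [leLHS](_ : _ = 2 / (1 + x ^+ 2) * ((1 + (u - x) ^+ 2) ^+ 2 * phi (u - x))); last ring.
rewrite [leRHS](_ : _ = 2 / (1 + x ^+ 2) * (16 ^+ 2 * bell (u - x))); last ring.
by apply: ler_wpM2l; [rewrite divr_ge0// ltW|exact: poly_phi_le_bell].
Qed.

Definition Cg : R := (2 * 16 ^+ 2) * Num.sqrt (8 * pi).
Definition cg : R := phi 1 / (3 * pi).

Lemma measurable_phigam x : measurable_fun [set: R] (fun u => phi (x - u) * gam u).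
Proof.
apply: measurable_funM measurable_gam.
by apply: measurableT_comp measurable_phi _; exact: measurable_funB.
Qed.

Lemma phigam_ge0 x u : 0 <= phi (x - u) * gam u.
Proof. by rewrite mulr_ge0 ?phi_ge0 ?gam_ge0. Qed.

(** The weight is kept so that one estimate bounds both [gconv] itself and the posterior second
    moment around x. *)
Lemma integral_weight_le x : (\int[leb]_u ((1 + (u - x) ^+ 2) * (phi (x - u) * gam u))%:E
   <= (Cg / (1 + x ^+ 2))%:E)%E.
Proof.
have dx : 0 < 1 + x ^+ 2 by rewrite ltr_pwDl ?sqr_ge0.
have -> : (Cg / (1 + x ^+ 2))%:E =
   (\int[leb]_u (((2 * 16 ^+ 2) / (1 + x ^+ 2))%:E * (bell (u - x))%:E))%E.
  rewrite ge0_integralZl_EFin//.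
  - by rewrite integral_bell -EFinM /Cg; congr EFin; ring.
  - by move=> u _; rewrite lee_fin expR_ge0.
  - by apply/measurable_EFinP; exact: measurable_bell.
  - by rewrite divr_ge0// ltW.
apply: le_integral_ge0 => u.
  by rewrite lee_fin mulr_ge0 ?phigam_ge0// addr_ge0 ?sqr_ge0.
by rewrite -EFinM lee_fin weight_gconv_le.
Qed.

Lemma gconvE x : (gconv x)%:E = (\int[leb]_u (phi (x - u) * gam u)%:E)%E.
Proof.
rewrite /gconv fineK// ge0_fin_numE; last first.
  by apply: integral_ge0 => u _; rewrite lee_fin phigam_ge0.
apply: le_lt_trans (ltry (Cg / (1 + x ^+ 2))).
apply: le_trans (integral_weight_le x); apply: le_integral_ge0 => u; rewrite lee_fin ?phigam_ge0//.
by rewrite ler_peMl ?phigam_ge0// lerDl sqr_ge0.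
Qed.

Lemma gconv_le x : gconv x <= Cg / (1 + x ^+ 2).
Proof.
rewrite -lee_fin gconvE; apply: le_trans (integral_weight_le x).
apply: le_integral_ge0 => u; rewrite lee_fin ?phigam_ge0//.
by rewrite ler_peMl ?phigam_ge0// lerDl sqr_ge0.
Qed.

Lemma cg_gt0 : 0 < cg.
Proof. by rewrite /cg divr_gt0 ?phi_gt0// mulr_gt0// pi_gt0. Qed.

Lemma Cg_gt0 : 0 < Cg.
Proof. by rewrite /Cg mulr_gt0// sqrtr_gt0 mulr_gt0// pi_gt0. Qed.

Lemma gam_ge x u : x <= u <= x + 1 -> (3 * pi)^-1 / (1 + x ^+ 2) <= gam u.
Proof.
move=> /andP[xu ux]; have pi0 := @pi_gt0 R.
have dx : 0 < 1 + x ^+ 2 by rewrite ltr_pwDl ?sqr_ge0.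
have du : 0 < 1 + u ^+ 2 by rewrite ltr_pwDl ?sqr_ge0.
rewrite /gam -invfM div1r lef_pV2 ?posrE ?mulr_gt0//.
rewrite [leRHS](_ : _ = pi * (3 * (1 + x ^+ 2))); last ring.
rewrite ler_pM2l//.
have : 0 <= (u - x) * (x + 1 - u) by rewrite mulr_ge0//; lra.
by have := sqr_ge0 (2 * x - u); have := sqr_ge0 x; lra.
Qed.

(** Only u in [x, x + 1] is kept: there [phi (x - u)] is at least [phi 1] and [gam_ge] bounds the
    prior. *)
Lemma gconv_ge x : cg / (1 + x ^+ 2) <= gconv x.
Proof.
have pi0 := @pi_gt0 R.
have dx : 0 < 1 + x ^+ 2 by rewrite ltr_pwDl ?sqr_ge0.
rewrite -lee_fin gconvE.
have := @le_integral_interval R [set: R] (fun u => phi (x - u) * gam u) x (x + 1) (cg / (1 + x ^+ 2)).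
rewrite (_ : x + 1 - x = 1) ?mulr1; last ring.
apply=> //.
- lra.
- by rewrite divr_ge0 ?ltW ?cg_gt0.
- by move=> u; exact: phigam_ge0.
- exact: measurable_phigam.
- move=> u /[dup] xu /andP[xu1 xu2]; rewrite /cg -[leLHS]mulrA; apply: ler_pM.
  + exact: phi_ge0.
  + by rewrite divr_ge0 ?invr_ge0 ?ltW// mulr_gt0.
  + apply: le_phi; rewrite expr1n.
    have : 0 <= (u - x) * (x + 1 - u) by rewrite mulr_ge0//; lra.
    by rewrite -sqrrN opprB; lra.
  + exact: gam_ge.
Qed.

Lemma gconv_gt0 x : 0 < gconv x.
Proof.
apply: lt_le_trans (gconv_ge x).
by rewrite divr_gt0 ?cg_gt0// ltr_pwDl ?sqr_ge0.
Qed.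

Let joint : R * R -> \bar R := fun z => (phi (z.1 - z.2) * gam z.2)%:E.

Let mjoint : measurable_fun [set: R * R] joint.
Proof.
apply/measurable_EFinP; apply: measurable_funM.
  apply: measurableT_comp measurable_phi _.
  by apply: measurable_funB; [exact: measurable_fst|exact: measurable_snd].
by apply: measurableT_comp measurable_gam _; exact: measurable_snd.
Qed.

Let joint_ge0 z : (0 <= joint z)%E. Proof. by rewrite lee_fin phigam_ge0. Qed.

Lemma measurable_gconv : measurable_fun [set: R] gconv.
Proof.
apply/measurable_EFinP.
have := @measurable_fun_fubini_tonelli_F _ _ _ _ _ leb joint mjoint joint_ge0.
by congr (measurable_fun _ _); apply/funext => x; rewrite /= gconvE.
Qed.

(** By Tonelli. Equality of the total masses of [gconv] and [phi] is what makes the mean of the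
    score vanish to first order on zero coordinates. *)
Lemma integral_gconv : (\int[leb]_x (gconv x)%:E = 1)%E.
Proof.
under eq_integral do rewrite gconvE.
rewrite (@fubini_tonelli _ _ _ _ _ leb leb joint mjoint joint_ge0).
rewrite -[RHS]integral_gam; apply: eq_integral => u _; rewrite /joint /=.
under eq_integral do rewrite mulrC EFinM.
rewrite ge0_integralZl_EFin ?gam_ge0 ?integral_phi ?mule1//.
- by move=> x _; rewrite lee_fin phi_ge0.
- by apply/measurable_EFinP; exact: measurable_phi_shift.
Qed.

End Densities.

(** * The posterior median threshold as a level of a monotone function *)

Section Threshold.
Context {R : realType}.
Local Notation leb := (@lebesgue_measure R).
Local Notation phi := (@phi R).
Local Notation gam := (@gam R).
Local Notation gconv := (@gconv R).
Local Notation tthr := (@tthr R).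
Implicit Types (x y u t a : R).

(** The likelihood ratio of N(u, 1) to N(0, 1) at x, times the prior density at u. *)
Definition tilt x u := expR (x * u - u ^+ 2 / 2) * gam u.

(* The part of gconv / phi due to u > 0; by symmetry the part due to u < 0 is
   htilt (- x). *)
Definition htilt x : R := fine (\int[leb]_(u in `]0%R, +oo[) (tilt x u)%:E)%E.

Lemma tilt_ge0 x u : 0 <= tilt x u.
Proof. by rewrite mulr_ge0 ?expR_ge0 ?gam_ge0. Qed.

Lemma phi_tilt x u : phi (x - u) * gam u = phi x * tilt x u.
Proof.
rewrite /phi /tilt.
have -> : - ((x - u) ^+ 2) / 2 = - (x ^+ 2) / 2 + (x * u - u ^+ 2 / 2) by field.
by rewrite expRD; ring.
Qed.

Lemma tiltE x u : tilt x u = (phi x)^-1 * (phi (x - u) * gam u).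
Proof. by rewrite phi_tilt mulKf// gt_eqF ?phi_gt0. Qed.

Lemma measurable_tilt x : measurable_fun [set: R] (tilt x).
Proof.
rewrite (_ : tilt x = fun u => (phi x)^-1 * (phi (x - u) * gam u)).
  by apply: measurable_funM => //; exact: measurable_phigam.
by apply/funext => u; exact: tiltE.
Qed.

Lemma integral_phigam_pos_le x : (\int[leb]_(u in `]0%R, +oo[) (phi (x - u) * gam u)%:E <= (gconv x)%:E)%E.
Proof.
rewrite gconvE; apply: ge0_subset_integral => //.
- by apply/measurable_EFinP; exact: measurable_phigam.
- by move=> u _; rewrite lee_fin phigam_ge0.
Qed.

Lemma integral_phigam_pos x :
  (\int[leb]_(u in `]0%R, +oo[) (phi (x - u) * gam u)%:E = (phi x * htilt x)%:E)%E.
Proof.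
have E : (\int[leb]_(u in `]0%R, +oo[) (tilt x u)%:E = (phi x)^-1%:E *
     \int[leb]_(u in `]0%R, +oo[) (phi (x - u) * gam u)%:E)%E.
  under eq_integral do rewrite tiltE EFinM.
  rewrite ge0_integralZl_EFin//.
  - by move=> u _; rewrite lee_fin phigam_ge0.
  - by apply/measurable_EFinP; apply: measurable_funTS; exact: measurable_phigam.
  - by rewrite invr_ge0 phi_ge0.
have I0 : (0 <= \int[leb]_(u in `]0%R, +oo[) (phi (x - u) * gam u)%:E)%E.
  by apply: integral_ge0 => u _; rewrite lee_fin phigam_ge0.
have fin : (\int[leb]_(u in `]0%R, +oo[) (phi (x - u) * gam u)%:E)%E \is a fin_num.
  by rewrite ge0_fin_numE// (le_lt_trans (integral_phigam_pos_le x))// ltry.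
rewrite /htilt E -(fineK fin) -EFinM /= mulrA divff ?mul1r//.
by rewrite gt_eqF// phi_gt0.
Qed.

Lemma htiltE x : (htilt x)%:E = (\int[leb]_(u in `]0%R, +oo[) (tilt x u)%:E)%E.
Proof.
under eq_integral do rewrite tiltE EFinM.
rewrite ge0_integralZl_EFin//.
- rewrite integral_phigam_pos -EFinM mulrA mulVf ?mul1r//.
  by rewrite gt_eqF// phi_gt0.
- by move=> u _; rewrite lee_fin phigam_ge0.
- by apply/measurable_EFinP; apply: measurable_funTS; exact: measurable_phigam.
- by rewrite invr_ge0 phi_ge0.
Qed.

Lemma integral_phigam_neg x :
  (\int[leb]_(u in `]-oo, 0%R[) (phi (x - u) * gam u)%:E = (phi x * htilt (- x))%:E)%E.
Proof.
have mE y D : measurable_fun D (fun u : R => (phi (y - u) * gam u)%:E).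
  by apply/measurable_EFinP; apply: measurable_funTS; exact: measurable_phigam.
(* The endpoint 0, of measure zero, is added for the substitution u -> - u and removed
   afterwards. *)
rewrite integral_itv_bndo_bndc//.
have := @ge0_integration_by_substitutionNy R (fun u => phi (x - u) * gam u) 0.
rewrite oppr0 => ->; last 2 first.
- apply: continuous_subspaceT => u; apply: cvgM; last exact: continuous_gam.
  apply: (@continuous_comp _ _ _ (fun u => x - u) phi); last exact: continuous_phi.
  by apply: cvgB => //; exact: cvg_cst.
- by move=> u _; exact: phigam_ge0.
rewrite -integral_itv_obnd_cbnd; last first.
  apply/measurable_EFinP; apply: measurable_funTS.
  apply: measurableT_comp (measurable_phigam x) _.
  exact: oppr_measurable.
rewrite -phiN -integral_phigam_pos; apply: eq_integral => u _.
by rewrite /= gamN -phiN; congr ((phi _ * _)%:E); ring.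
Qed.

Lemma gconv_tilt x : gconv x = phi x * (htilt x + htilt (- x)).
Proof.
apply: EFin_inj; rewrite gconvE mulrDr EFinD -integral_phigam_pos -integral_phigam_neg.
have mE D : measurable_fun D (fun u : R => (phi (x - u) * gam u)%:E).
  by apply/measurable_EFinP; apply: measurable_funTS; exact: measurable_phigam.
rewrite [X in (_ + X)%E]integral_itv_bndo_bndc// addeC.
have U : `]-oo, 0%R] `|` `]0%R, +oo[ = [set: R].
  apply/seteqP; split => u //= _.
  by rewrite !in_itv/= andbT; case: (leP u 0) => h; [left|right].
rewrite -ge0_integral_setU ?U//.
- exact: mE.
- by move=> u _; rewrite lee_fin phigam_ge0.
- rewrite disj_set2E; apply/eqP/seteqP; split => u //=.
  by rewrite !in_itv/= andbT => -[]; case: leP.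
Qed.

Lemma htilt_ge0 x : 0 <= htilt x.
Proof. by rewrite fine_ge0//; apply: integral_ge0 => u _; rewrite lee_fin tilt_ge0. Qed.

Definition ktilt : R := expR (- 2) * gam 2.

Lemma ktilt_gt0 : 0 < ktilt.
Proof. by rewrite mulr_gt0 ?expR_gt0 ?gam_gt0. Qed.

(** Since exp(x u) >= 1, exp(y u) - exp(x u) >= (y - x) u. The resulting minorant is integrated over
    u in [1, 2] only, where u exp(- u^2 / 2) gam(u) is at least [ktilt]. *)
Lemma htilt_incr x y : 0 <= x -> x <= y -> htilt x + (y - x) * ktilt <= htilt y.
Proof.
move=> x0 xy.
pose f u := u * (expR (- (u ^+ 2) / 2) * gam u).
have mexp : measurable_fun [set: R] (fun u => expR (- (u ^+ 2) / 2)).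
  apply: continuous_measurable_fun => u.
  apply: continuous_comp; last exact: continuous_expR.
  by apply: cvgMr_tmp; apply: cvgN; exact: exprn_continuous.
(* The absolute value makes the minorant nonnegative on the whole line, as [le_integral_interval]
   requires; it is invisible for u > 0. *)
have mf : measurable_fun [set: R] (fun u => (y - x) * f `|u|).
  apply: measurable_funM => //; apply: (@measurableT_comp _ _ _ _ _ _ f).
    apply: measurable_funM => //; apply: measurable_funM mexp _.
    exact: measurable_gam.
  exact: normr_measurable.
have f0 u : 0 <= (y - x) * f `|u|.
  by rewrite mulr_ge0 ?subr_ge0// mulr_ge0// mulr_ge0 ?expR_ge0 ?gam_ge0.
rewrite -lee_fin EFinD !htiltE.
apply: (@le_trans _ _ (\int[leb]_(u in `]0%R, +oo[) (tilt x u + (y - x) * f `|u|)%:E)%E).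
  under [leRHS]eq_integral do rewrite EFinD.
  rewrite ge0_integralD//.
  - rewrite leeD2l//.
    have := @le_integral_interval R `]0%R, +oo[ (fun u => (y - x) * f `|u|) 1 2 ((y - x) * ktilt).
    rewrite (_ : 2 - 1 = 1) ?mulr1; last by ring.
    have l12 : 1 <= 2 :> R by lra.
    apply => //.
    + by rewrite mulr_ge0 ?subr_ge0// ltW ?ktilt_gt0.
    + by move=> u; rewrite /= !in_itv/= andbT; lra.
    + move=> u /andP[u1 u2]; rewrite ler_wpM2l ?subr_ge0//.
      rewrite /f ger0_norm; last lra.
      rewrite -[leLHS]mul1r; apply: ler_pM => //.
        by rewrite ltW// ktilt_gt0.
      apply: ler_pM; rewrite ?expR_ge0 ?gam_ge0//.
        by rewrite ler_expR; nra.
      rewrite /gam ler_pM2l// lef_pV2 ?posrE ?mulr_gt0 ?pi_gt0 ?ltr_pwDl ?sqr_ge0//.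
      by rewrite ler_pM2l ?pi_gt0// lerD2l lerXn2r// nnegrE; lra.
  - by move=> u _; rewrite lee_fin tilt_ge0.
  - by apply/measurable_EFinP; apply: measurable_funTS; exact: measurable_tilt.
  - by move=> u _; rewrite lee_fin.
  - by apply/measurable_EFinP; apply: measurable_funTS.
apply: ge0_le_integral => //.
- by move=> u _; rewrite lee_fin addr_ge0 ?tilt_ge0.
- by apply/measurable_EFinP; apply: measurable_funTS; apply: measurable_funD mf; exact: measurable_tilt.
- by apply/measurable_EFinP; apply: measurable_funTS; exact: measurable_tilt.
- move=> u; rewrite /= in_itv/= andbT => u0.
  rewrite lee_fin /f gtr0_norm// /tilt !expRD.
  rewrite [leLHS](_ : _ = (expR (x * u) + (y - x) * u) * (expR (- (u ^+ 2 / 2)) * gam u)); last first.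
    by rewrite mulNr; ring.
  rewrite -[leRHS]mulrA; apply: ler_wpM2r.
    by rewrite mulr_ge0 ?expR_ge0 ?gam_ge0.
  have e1 : 1 <= expR (x * u) by rewrite -expR0 ler_expR mulr_ge0// ltW.
  have -> : y * u = x * u + (y - x) * u by ring.
  rewrite expRD; have := expR_ge1Dx ((y - x) * u).
  have : 0 <= (y - x) * u by rewrite mulr_ge0 ?subr_ge0// ltW.
  nra.
Qed.

Lemma htilt_mono x y : x <= y -> htilt x <= htilt y.
Proof.
move=> xy; rewrite -lee_fin !htiltE; apply: ge0_le_integral => //.
- by move=> u _; rewrite lee_fin tilt_ge0.
- by apply/measurable_EFinP; apply: measurable_funTS; exact: measurable_tilt.
- by apply/measurable_EFinP; apply: measurable_funTS; exact: measurable_tilt.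
- move=> u; rewrite /= in_itv/= andbT => u0.
  rewrite lee_fin ler_wpM2r ?gam_ge0// ler_expR lerD2r ler_pM2r//.
Qed.

(** Relative to [phi x], the excess of the slab mass on u > 0 over that on u < 0. *)
Definition hodd x := htilt x - htilt (- x).

Lemma hodd0 : hodd 0 = 0. Proof. by rewrite /hodd oppr0 subrr. Qed.

Lemma hodd_incr x y : 0 <= x -> x <= y -> hodd x + (y - x) * ktilt <= hodd y.
Proof.
move=> x0 xy; have := htilt_incr x0 xy.
have : htilt (- y) <= htilt (- x) by rewrite htilt_mono// lerN2.
rewrite /hodd; move: (htilt x) (htilt y) (htilt (- x)) (htilt (- y)) => *; lra.
Qed.

Lemma hodd_ge x : 0 <= x -> x * ktilt <= hodd x.
Proof. by move=> x0; have := hodd_incr (lexx 0) x0; rewrite hodd0 add0r subr0. Qed.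

(** For x >= 0 the positive half-line carries the larger mass, so one condition remains: a h <= ((1
    - a) + a (h + h')) / 2 with h = [htilt x] and h' = [htilt (- x)], that is, a (h - h') <= 1 -
    a. *)
Lemma median_is0P a x : 0 < a -> a <= 1 -> 0 <= x ->
  median_is0 a x <-> a * hodd x <= 1 - a.
Proof.
move=> a0 a1 x0; have g0 := gconv_gt0 x; have p0 := phi_gt0 x.
have den0 : 0 < (1 - a) * phi x + a * gconv x.
  by rewrite ltr_wpDl ?mulr_gt0// mulr_ge0 ?phi_ge0//; lra.
have GE (D : set R) h : measurable D ->
    (\int[leb]_(u in D) (phi (x - u) * gam u)%:E = h%:E)%E -> Gx x D = h / gconv x.
  move=> mD hE; rewrite /Gx /gamx.
  under eq_integral do rewrite mulrC EFinM.
  rewrite ge0_integralZl_EFin//.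
  - by rewrite hE -EFinM mulrC.
  - by move=> u _; rewrite lee_fin phigam_ge0.
  - by apply/measurable_EFinP; apply: measurable_funTS; exact: measurable_phigam.
  - by rewrite invr_ge0 ltW.
have apG h : apost a x * (h / gconv x) = a * h / ((1 - a) * phi x + a * gconv x).
  by rewrite /apost; field; rewrite !gt_eqF.
rewrite /median_is0 (GE _ _ _ (integral_phigam_neg x))// (GE _ _ _ (integral_phigam_pos x))//.
rewrite !apG; move: den0; rewrite gconv_tilt /hodd.
have : htilt (- x) <= htilt x by apply: htilt_mono; lra.
move: (htilt x) (htilt (- x)) (phi x) p0 => h h' p p0 hh' den0.
rewrite !ler_pdivrMr//; split=> [[_ le_h]|le_h].
  by rewrite -(ler_pM2r p0); lra.
have : a * (h - h') * p <= (1 - a) * p by rewrite ler_pM2r.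
have : 0 <= a * (h - h') * p by rewrite !mulr_ge0 ?subr_ge0// ltW.
by split; lra.
Qed.

Definition median_set a := [set x : R | 0 <= x /\ median_is0 a x].

Lemma has_sup_median_set a : 0 < a -> a <= 1 -> has_sup (median_set a).
Proof.
move=> a0 a1; split.
  exists 0; split => //; apply/(median_is0P a0 a1 (lexx 0)).
  by rewrite hodd0 mulr0; lra.
exists ((1 - a) / (a * ktilt)) => x [x0 /(median_is0P a0 a1 x0) h].
rewrite ler_pdivlMr; last exact: mulr_gt0 ktilt_gt0.
by apply: le_trans h; rewrite mulrCA ler_pM2l// hodd_ge.
Qed.

(** Take a with (1 - a) / a = [hodd y]. As [hodd] is strictly increasing on the half-line, the
    median set is then exactly [0, y]. *)
Lemma tthr_surj y : 0 < y -> exists a, 0 < a < 1 /\ tthr a = y.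
Proof.
move=> y0; have h0 : 0 < hodd y.
  by apply: lt_le_trans (hodd_ge (ltW y0)); rewrite mulr_gt0 ?ktilt_gt0.
exists (1 + hodd y)^-1; split.
  by rewrite invr_gt0 invf_lt1; lra.
rewrite /tthr -[RHS](sup_itvcc (ltW y0)); congr (sup _).
have h1 : 0 < 1 + hodd y by rewrite addr_gt0.
have a0 : 0 < (1 + hodd y)^-1 by rewrite invr_gt0.
have a1 : (1 + hodd y)^-1 <= 1 by rewrite invf_le1// lerDl ltW.
have E x : 0 <= x -> (median_is0 (1 + hodd y)^-1 x <-> hodd x <= hodd y).
  move=> x0; apply: (iff_trans (median_is0P a0 a1 x0)).
  rewrite mulrC ler_pdivrMr// mulrBl mulVf ?(gt_eqF h1)//.
  by rewrite mul1r addrC addKr.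
apply/seteqP; split => x /=; rewrite in_itv/=.
  move=> [x0 /(E _ x0) hx]; rewrite x0 leNgt; apply/negP => yx.
  have := le_trans (hodd_incr (ltW y0) (ltW yx)) hx.
  by rewrite gerDl leNgt (mulr_gt0 _ ktilt_gt0)// subr_gt0.
move=> /andP[x0 xy]; split => //; apply/(E _ x0).
apply: le_trans (hodd_incr x0 xy).
by rewrite lerDl (mulr_ge0 _ (ltW ktilt_gt0))// subr_ge0.
Qed.

End Threshold.

(** * Two-sided bounds between a weight and its threshold *)

Section ThresholdBounds.
Context {R : realType}.
Local Notation leb := (@lebesgue_measure R).
Local Notation phi := (@phi R).
Local Notation gam := (@gam R).
Local Notation gconv := (@gconv R).
Local Notation tthr := (@tthr R).
Implicit Types (x y u t a : R).

(** By surjectivity the default value 0 of [tinv] is never taken at y > 0. *)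
Lemma tinvP y : 0 < y -> 0 < tinv y < 1 /\ tthr (tinv y) = y.
Proof. by move=> /tthr_surj; exact: xgetPex. Qed.

Lemma htilt0_le1 : htilt 0 <= 1 :> R.
Proof.
rewrite -lee_fin htiltE -[leRHS]integral_gam.
apply: (@le_trans _ _ (\int[leb]_(u in `]0%R, +oo[) (gam u)%:E)%E).
  apply: ge0_le_integral => //.
  - by move=> u _; rewrite lee_fin tilt_ge0.
  - by apply/measurable_EFinP; apply: measurable_funTS; exact: measurable_tilt.
  - by apply/measurable_EFinP; apply: measurable_funTS; exact: measurable_gam.
  - move=> u _; rewrite lee_fin /tilt ler_piMl ?gam_ge0// expR_le1.
    by have := sqr_ge0 u; lra.
apply: ge0_subset_integral => //.
- by apply/measurable_EFinP; exact: measurable_gam.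
- by move=> u _; rewrite lee_fin gam_ge0.
Qed.

(** On [x, x + 1] the exponent x u - u^2 / 2 stays within 1/2 of its maximum x^2 / 2. *)
Lemma htilt_ge x : 0 < x ->
  expR (- 2^-1) / (3 * pi) * (expR (x ^+ 2 / 2) / (1 + x ^+ 2)) <= htilt x.
Proof.
move=> x0; have pi0 := @pi_gt0 R.
have dx : 0 < 1 + x ^+ 2 by rewrite ltr_pwDl ?sqr_ge0.
rewrite -lee_fin htiltE.
have := @le_integral_interval R `]0%R, +oo[ (tilt x) x (x + 1)
  (expR (- 2^-1) / (3 * pi) * (expR (x ^+ 2 / 2) / (1 + x ^+ 2))).
rewrite (_ : x + 1 - x = 1) ?mulr1; last by ring.
have xx1 : x <= x + 1 by lra.
apply => //.
- by rewrite mulr_ge0// divr_ge0 ?expR_ge0// ?mulr_ge0// ltW.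
- by move=> u; rewrite /= !in_itv/= andbT; lra.
- by move=> u; exact: tilt_ge0.
- exact: measurable_tilt.
- move=> u xu; rewrite /tilt.
  rewrite [leLHS](_ : _ = expR (- 2^-1 + x ^+ 2 / 2) * ((3 * pi)^-1 / (1 + x ^+ 2))); last first.
    by rewrite expRD; ring.
  apply: ler_pM.
  + exact: expR_ge0.
  + by rewrite divr_ge0 ?invr_ge0 ?mulr_ge0// ltW.
  + move/andP: xu => [xu1 xu2]; rewrite ler_expR.
    have : 0 <= (u - x) * (x + 1 - u) by rewrite mulr_ge0//; lra.
    lra.
  + exact: gam_ge.
Qed.

Definition Ct : R := 3 * pi * expR 2^-1.

Lemma Ct_gt0 : 0 < Ct.
Proof. by rewrite mulr_gt0 ?expR_gt0// mulr_gt0// pi_gt0. Qed.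

(** From a (h - h') <= 1 - a and h' <= 1 follows a h <= 1, with h and h' the values of [htilt] at x
    and - x; the growth of h in [htilt_ge] does the rest. *)
Lemma median_set_le a x : 0 < a -> a <= 1 -> 0 < x -> median_set a x ->
  a <= Ct * ((1 + x ^+ 2) * expR (- (x ^+ 2 / 2))).
Proof.
move=> a0 a1 x0 [_ /(median_is0P a0 a1 (ltW x0))].
have dx : 0 < 1 + x ^+ 2 by rewrite ltr_pwDl ?sqr_ge0.
have : htilt (- x) <= 1 by apply: le_trans htilt0_le1; apply: htilt_mono; lra.
have := htilt_ge x0; rewrite /hodd; move: (htilt x) (htilt (- x)) => h h' hx h'1 ah.
have ah1 : a * h <= 1 by nra.
set K := (X in X <= h) in hx.
have K0 : 0 < K.
  by rewrite mulr_gt0 ?divr_gt0 ?expR_gt0// ?mulr_gt0 ?pi_gt0.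
have -> : Ct * ((1 + x ^+ 2) * expR (- (x ^+ 2 / 2))) = K^-1.
  by rewrite /K /Ct !invfM !invrK !expRN invrK; ring.
rewrite -[leRHS]mul1r ler_pdivlMr// (le_trans _ ah1)//.
by rewrite ler_pM2l.
Qed.

(** Normalised so that [htilt_le] reads cT htilt(x) <= exp(x^2 / 2) / 2. *)
Definition cT : R := (2 * Cg * Num.sqrt (2 * pi))^-1.

Lemma cT_gt0 : 0 < cT.
Proof. by rewrite invr_gt0 mulr_gt0 ?mulr_gt0 ?Cg_gt0// sqrtr_gt0 mulr_gt0// pi_gt0. Qed.

Lemma cT_le : cT <= 2^-1.
Proof.
have s1 := @sqrt2pi_ge1 R.
have s2 : 1 <= Num.sqrt (8 * pi) :> R.
  apply: le_trans s1 _; rewrite ler_sqrt; last by rewrite mulr_ge0// pi_ge0.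
  by rewrite ler_pM2r ?pi_gt0//; lra.
rewrite /cT lef_pV2 ?posrE//; last first.
  by rewrite mulr_gt0 ?mulr_gt0 ?Cg_gt0// sqrtr_gt0 mulr_gt0// pi_gt0.
have Cg1 : 1 <= Cg :> R.
  rewrite /Cg; move: (Num.sqrt (8 * pi)) s2 => z z1.
  have : 1 <= 16 ^+ 2 :> R by rewrite exprn_ege1//; lra.
  by move: (16 ^+ 2) => w w1; nra.
by move: (Num.sqrt _) Cg s1 Cg1 => *; nra.
Qed.

Lemma htilt_le x : htilt x <= Cg * Num.sqrt (2 * pi) * expR (x ^+ 2 / 2).
Proof.
have p0 := phi_gt0 x.
have s0 : 0 < Num.sqrt (2 * pi) :> R := lt_le_trans ltr01 (@sqrt2pi_ge1 R).
have dx : 0 < 1 + x ^+ 2 by rewrite ltr_pwDl ?sqr_ge0.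
have E : Num.sqrt (2 * pi) * expR (x ^+ 2 / 2) = (phi x)^-1.
  by rewrite /phi invfM invrK mulNr expRN invrK mulrC.
rewrite -mulrA E ler_pdivlMr// mulrC.
apply: (@le_trans _ _ (gconv x)).
  by rewrite gconv_tilt mulrDr lerDl mulr_ge0 ?htilt_ge0 ?phi_ge0.
apply: le_trans (gconv_le x) _.
rewrite ler_pdivrMr// ler_peMr ?(ltW Cg_gt0)// lerDl sqr_ge0.
by [].
Qed.

(** By contradiction: for a smaller [a], the point x with x^2 / 2 = ln (cT / a) lies beyond t, yet a
    hodd(x) <= 1/2 <= 1 - a puts it in the median set. *)
Lemma tthr_le_lb a t : 0 < a -> a <= 1 -> 0 <= t -> tthr a <= t ->
  cT * expR (- (t ^+ 2 / 2)) <= a.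
Proof.
move=> a0 a1 t0 at_; rewrite leNgt; apply/negP => aT.
have c0 := cT_gt0; have c2 := cT_le.
have ac : a < cT.
  apply: lt_le_trans aT _; rewrite ler_piMr ?(ltW c0)// expR_le1.
  by have := sqr_ge0 t; lra.
have r0 : 0 < cT / a by rewrite divr_gt0.
have lt : t ^+ 2 / 2 < ln (cT / a).
  rewrite -ltr_expR lnK ?posrE// ltr_pdivlMr// mulrC -ltr_pdivlMr ?expR_gt0//.
  by rewrite -expRN.
set l := ln (cT / a) in lt.
have l0 : 0 <= 2 * l by have := sqr_ge0 t; lra.
have x2 : Num.sqrt (2 * l) ^+ 2 = 2 * l by rewrite sqr_sqrtr.
set x := Num.sqrt (2 * l) in x2.
have x0 : 0 <= x by rewrite sqrtr_ge0.
have tx : t < x by rewrite -(@ltr_pXn2r _ 2) ?nnegrE//; lra.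
have ms : median_set a x.
  split => //; apply/(median_is0P a0 a1 x0).
  have hx := htilt_le x.
  have hh : hodd x <= htilt x by rewrite /hodd lerBlDr lerDl htilt_ge0.
  have ah : a * hodd x <= a * (Cg * Num.sqrt (2 * pi) * expR (x ^+ 2 / 2)).
    by rewrite ler_pM2l// (le_trans hh).
  apply: le_trans ah _.
  have -> : x ^+ 2 / 2 = l by rewrite x2; field.
  rewrite /l lnK ?posrE//.
  have s0 : 0 < Num.sqrt (2 * pi) :> R := lt_le_trans ltr01 (@sqrt2pi_ge1 R).
  have Cg0 := @Cg_gt0 R.
  rewrite [leLHS](_ : _ = 2^-1); first by move: ac c2; lra.
  by rewrite /cT; field; rewrite !gt_eqF.
have := ub_le_sup (has_sup_median_set a0 a1).2 ms; rewrite -/(tthr a) => xt.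
by have := le_lt_trans (le_trans xt at_) tx; rewrite ltxx.
Qed.

(** The supremum need not be attained, so [median_set_le] is used at a point x > y - 1/y; then x^2 /
    2 >= y^2 / 2 - 1, which costs the factor [expR 1]. *)
Lemma tthr_eq_ub a y : 0 < a -> a <= 1 -> 1 <= y -> tthr a = y ->
  a <= expR 1 * Ct * ((1 + y ^+ 2) * expR (- (y ^+ 2 / 2))).
Proof.
move=> a0 a1 y1 ay.
have yi : 0 < y^-1 by rewrite invr_gt0; lra.
have [x ms] := sup_adherent yi (has_sup_median_set a0 a1).
rewrite -/(tthr a) ay => yx.
have := ub_le_sup (has_sup_median_set a0 a1).2 ms; rewrite -/(tthr a) ay => xy.
have yi1 : y^-1 <= 1 by rewrite invf_le1; lra.
have x0 : 0 < x by lra.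
apply: le_trans (median_set_le a0 a1 x0 ms) _.
rewrite [X in _ <= X * _]mulrC -[leRHS]mulrA ler_pM2l ?Ct_gt0//.
rewrite mulrCA -expRD; apply: ler_pM; rewrite ?expR_ge0//.
- by rewrite addr_ge0 ?sqr_ge0.
- by rewrite lerD2l lerXn2r// nnegrE; lra.
- rewrite ler_expR.
  have yy : y * y^-1 = 1 by rewrite divff// gt_eqF//; lra.
  have : (y - y^-1) ^+ 2 <= x ^+ 2 by rewrite lerXn2r// ?nnegrE; lra.
  have := sqr_ge0 y^-1.
  rewrite sqrrB yy; lra.
Qed.

(** Half of the Gaussian exponent is spent on the factor 1 + x^2, leaving an expression that
    decreases in x and can be evaluated at t. *)
Lemma tthr_gt_ub a t : 0 < a -> a <= 1 -> 0 <= t -> t < tthr a ->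
  a <= 4 * Ct * expR (- (t ^+ 2 / 4)).
Proof.
move=> a0 a1 t0 ta.
have [x ms tx] := sup_gt (has_sup_median_set a0 a1).1 ta.
have x0 : 0 < x by lra.
apply: le_trans (median_set_le a0 a1 x0 ms) _.
rewrite [X in _ <= X * _]mulrC -[leRHS]mulrA ler_pM2l ?Ct_gt0//.
apply: (@le_trans _ _ (4 * expR (x ^+ 2 / 4) * expR (- (x ^+ 2 / 2)))).
  by rewrite ler_pM2r ?expR_gt0//; have := expR_ge1Dx (x ^+ 2 / 4); lra.
rewrite -mulrA ler_pM2l// -expRD ler_expR.
have : t ^+ 2 <= x ^+ 2 by rewrite lerXn2r// ?nnegrE; lra.
lra.
Qed.

End ThresholdBounds.

(** * Posterior quadratic loss, coordinate by coordinate *)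

Section PosteriorRisk.
Context {R : realType}.
Local Notation leb := (@lebesgue_measure R).
Local Notation phi := (@phi R).
Local Notation gam := (@gam R).
Local Notation gconv := (@gconv R).
Implicit Types (x y u t a mu alpha : R) (X theta : nat -> R).

Lemma data_coord_positive theta i : positive_functional (data_coord theta i).
Proof.
apply: integral_weight_positive => [x|]; first exact: phi_ge0.
exact: measurable_phi_shift.
Qed.

Lemma data_coord1 theta i : (data_coord theta i (fun=> 1) <= 1)%E.
Proof.
rewrite /data_coord; under eq_integral do rewrite mul1e.
by rewrite integral_phi.
Qed.

Lemma gamx_ge0 x u : 0 <= gamx x u.
Proof. by rewrite divr_ge0 ?phigam_ge0// ltW// gconv_gt0. Qed.

Lemma measurable_gamx x : measurable_fun [set: R] (gamx x).
Proof. by apply: measurable_funM => //; exact: measurable_phigam. Qed.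

Lemma mixture_den_gt0 alpha x : 0 <= alpha <= 1 ->
  0 < (1 - alpha) * phi x + alpha * gconv x.
Proof.
move=> /andP[a0 a1]; have p0 := phi_gt0 x; have g0 := gconv_gt0 x.
by move: (phi x) (gconv x) p0 g0 => p g p0 g0; nra.
Qed.

Lemma apost_ge0 alpha x : 0 <= alpha <= 1 -> 0 <= apost alpha x.
Proof.
move=> a01; rewrite divr_ge0 ?(ltW (mixture_den_gt0 _ a01))//.
by case/andP: a01 => a0 _; rewrite mulr_ge0// ltW// gconv_gt0.
Qed.

Lemma apostC alpha x : 0 <= alpha <= 1 ->
  1 - apost alpha x = (1 - alpha) * phi x / ((1 - alpha) * phi x + alpha * gconv x).
Proof.
move=> a01; have := mixture_den_gt0 x a01 => d0.
apply: (mulIf (lt0r_neq0 d0)).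
by rewrite /apost mulrBl !divfK ?lt0r_neq0//; ring.
Qed.

Lemma apostC_ge0 alpha x : 0 <= alpha <= 1 -> 0 <= 1 - apost alpha x.
Proof.
move=> a01; rewrite apostC// divr_ge0 ?(ltW (mixture_den_gt0 _ a01))//.
by case/andP: a01 => _ a1; rewrite mulr_ge0 ?phi_ge0// subr_ge0.
Qed.

Lemma post_coord_positive alpha X i : 0 <= alpha <= 1 ->
  positive_functional (post_coord alpha X i).
Proof.
move=> a01; have [P1 P2 P3] :=
  integral_weight_positive (gamx_ge0 (X i)) (measurable_gamx (X i)).
have a0 := apost_ge0 (X i) a01; have c0 := apostC_ge0 (X i) a01.
split.
- by move=> f f0; rewrite adde_ge0// mule_ge0 ?lee_fin//; exact: P1.
- move=> f g f0 fg; rewrite leeD// lee_wpmul2l ?lee_fin//; exact: P2.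
- move=> I l c f cc f0 mf; rewrite /post_coord P3//.
  rewrite -sumEFin !ge0_sume_distrr//; last 2 first.
  + by move=> t _; rewrite mule_ge0 ?lee_fin//; apply: P1 => u; rewrite lee_fin.
  + by move=> t _; rewrite lee_fin mulr_ge0.
  rewrite -big_split/=; apply: eq_bigr => t _.
  have : (0 <= \int[leb]_u ((EFin \o f t) u * (gamx (X i) u)%:E))%E.
    by apply: P1 => u; rewrite lee_fin.
  move: (integral _ _ _) => J J0.
  rewrite [RHS]ge0_muleDr ?mule_ge0 ?lee_fin//.
  by rewrite -!EFinM mulrCA; congr (_ + _)%E; rewrite muleCA.
Qed.

Lemma integral_gamx x : (\int[leb]_u (gamx x u)%:E = 1)%E.
Proof.
under eq_integral do rewrite /gamx mulrC EFinM.
rewrite ge0_integralZl_EFin//.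
- by rewrite -gconvE -EFinM mulVf// gt_eqF// gconv_gt0.
- by move=> u _; rewrite lee_fin phigam_ge0.
- by apply/measurable_EFinP; exact: measurable_phigam.
- by rewrite invr_ge0 ltW// gconv_gt0.
Qed.

Lemma post_coord1 alpha X i : 0 <= alpha <= 1 ->
  (post_coord alpha X i (fun=> 1) <= 1)%E.
Proof.
move=> a01; rewrite /post_coord; under eq_integral do rewrite mul1e.
by rewrite integral_gamx !mule1 -EFinD subrK.
Qed.

Definition Cp : R := Cg / cg.

Lemma Cp_gt0 : 0 < Cp. Proof. by rewrite divr_gt0 ?Cg_gt0 ?cg_gt0. Qed.

(** The numerator and the normalisation [gconv x] are both of order 1 / (1 + x^2), so the slab
    posterior has bounded second moment around x, uniformly in x. *)
Lemma integral_weight_gamx x :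
  (\int[leb]_u ((u - x) ^+ 2 * gamx x u)%:E <= Cp%:E)%E.
Proof.
have g0 := gconv_gt0 x; have dx : 0 < 1 + x ^+ 2 by rewrite ltr_pwDl ?sqr_ge0.
apply: (@le_trans _ _ (\int[leb]_u ((gconv x)^-1%:E *
    ((1 + (u - x) ^+ 2) * (phi (x - u) * gam u))%:E))%E).
  apply: le_integral_ge0 => u; first by rewrite lee_fin mulr_ge0 ?gamx_ge0 ?sqr_ge0.
  rewrite -EFinM lee_fin /gamx.
  rewrite [leLHS](_ : _ = (gconv x)^-1 * ((u - x) ^+ 2 * (phi (x - u) * gam u))); last by ring.
  by rewrite ler_wpM2l ?invr_ge0 ?(ltW g0)// ler_wpM2r ?phigam_ge0// lerDr.
rewrite ge0_integralZl_EFin//; last 3 first.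
- by move=> u _; rewrite lee_fin mulr_ge0 ?phigam_ge0// addr_ge0 ?sqr_ge0.
- apply/measurable_EFinP; apply: measurable_funM; last exact: measurable_phigam.
  by apply: measurable_funD => //; apply: measurable_funX; exact: measurable_funB.
- by rewrite invr_ge0 ltW.
apply: (@le_trans _ _ ((gconv x)^-1%:E * (Cg / (1 + x ^+ 2))%:E)%E).
  by rewrite lee_wpmul2l ?lee_fin ?invr_ge0 ?(ltW g0)// integral_weight_le.
rewrite -EFinM lee_fin mulrC ler_pdivrMr//.
apply: le_trans (_ : Cp * (cg / (1 + x ^+ 2)) <= _).
  by rewrite /Cp mulrA divfK// gt_eqF// cg_gt0.
by rewrite ler_pM2l ?Cp_gt0// gconv_ge.
Qed.

Lemma integral_sqr_gamx x mu :
  (\int[leb]_u (((u - mu) ^+ 2)%:E * (gamx x u)%:E) <=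
   (2 * (x - mu) ^+ 2 + 2 * Cp)%:E)%E.
Proof.
have mG := measurable_gamx x.
have mW : measurable_fun [set: R] (fun u => (u - x) ^+ 2 * gamx x u).
  by apply: measurable_funM mG; apply: measurable_funX; exact: measurable_funB.
have W0 u : 0 <= (u - x) ^+ 2 * gamx x u by rewrite mulr_ge0 ?gamx_ge0 ?sqr_ge0.
apply: (@le_trans _ _ (\int[leb]_u ((2 * (x - mu) ^+ 2)%:E * (gamx x u)%:E +
    2%:E * ((u - x) ^+ 2 * gamx x u)%:E))%E).
  apply: le_integral_ge0 => u.
    by rewrite -EFinM lee_fin mulr_ge0 ?gamx_ge0 ?sqr_ge0.
  rewrite -!EFinM -EFinD lee_fin.
  rewrite [leRHS](_ : _ = (2 * (x - mu) ^+ 2 + 2 * (u - x) ^+ 2) * gamx x u); last by ring.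
  rewrite ler_wpM2r ?gamx_ge0//.
  by have := sqr_ge0 ((x - mu) - (u - x)); lra.
have s0 : 0 <= 2 * (x - mu) ^+ 2 by rewrite mulr_ge0 ?sqr_ge0.
rewrite ge0_integralD//; last 4 first.
- by move=> u _; rewrite -EFinM lee_fin mulr_ge0 ?gamx_ge0.
- by apply/measurable_EFinP; exact: measurable_funM.
- by move=> u _; rewrite -EFinM lee_fin mulr_ge0.
- by apply/measurable_EFinP; exact: measurable_funM.
rewrite !ge0_integralZl_EFin//; last 4 first.
- by move=> u _; rewrite lee_fin.
- exact/measurable_EFinP.
- by move=> u _; rewrite lee_fin gamx_ge0.
- exact/measurable_EFinP.
rewrite integral_gamx mule1 [leRHS]EFinD leeD2l// EFinM lee_wpmul2l ?lee_fin//.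
exact: integral_weight_gamx.
Qed.

(** When mu = 0 the atom at 0 costs nothing. Otherwise it costs mu^2, which is traded for 2 x^2 + 2
    (x - mu)^2 so that only the observation appears next to its weight. *)
Definition coord_loss alpha mu x : R :=
  if mu == 0 then apost alpha x * (2 * x ^+ 2 + 2 * Cp)
  else 2 * (x - mu) ^+ 2 + 2 * ((1 - apost alpha x) * x ^+ 2) + 2 * Cp.

Lemma post_coord_loss alpha X i mu : 0 <= alpha <= 1 ->
  (post_coord alpha X i (EFin \o (fun u => (u - mu) ^+ 2)%R) <=
   (coord_loss alpha mu (X i))%:E)%E.
Proof.
move=> a01; have a0 := apost_ge0 (X i) a01; have c0 := apostC_ge0 (X i) a01.
have P0 := Cp_gt0.
apply: (@le_trans _ _ ((1 - apost alpha (X i)) * mu ^+ 2 +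
    apost alpha (X i) * (2 * (X i - mu) ^+ 2 + 2 * Cp))%:E).
  rewrite EFinD leeD//.
    by rewrite /= sub0r sqrrN -EFinM.
  by rewrite [leRHS]EFinM lee_wpmul2l ?lee_fin// integral_sqr_gamx.
rewrite lee_fin /coord_loss; case: eqP => [->|_].
  by rewrite expr0n/= mulr0 add0r subr0.
move: a0 c0; move: (apost alpha (X i)) => a a0 c0; move: (X i) => x.
have h : mu ^+ 2 <= 2 * x ^+ 2 + 2 * (x - mu) ^+ 2.
  by have := sqr_ge0 (2 * x - mu); lra.
have : (1 - a) * mu ^+ 2 <= (1 - a) * (2 * x ^+ 2 + 2 * (x - mu) ^+ 2).
  by rewrite ler_wpM2l.
have : 0 <= (1 - a) * Cp by rewrite mulr_ge0// ltW.
have := sqr_ge0 (x - mu); have := sqr_ge0 x; lra.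
Qed.

Lemma post_risk_le n alpha X theta : 0 <= alpha <= 1 ->
  (post_risk n alpha X theta <=
   (\sum_(i < n) coord_loss alpha (theta i) (X i))%:E)%E.
Proof.
move=> a01; apply: le_iterint_bound.
- by move=> i; exact: post_coord_positive.
- by move=> eta; rewrite lee_fin; apply: sumr_ge0 => i _; exact: sqr_ge0.
- by move=> eta; exact: lexx.
- apply: sum_prod_bound_sum => j.
  apply: (@sum_prod_bound1 _ _ n j (fun u => (u - theta j) ^+ 2)).
  + by move=> i; exact: post_coord1.
  + by move=> x; exact: sqr_ge0.
  + by apply: measurable_funX; exact: measurable_funB.
  + exact: post_coord_loss.
Qed.

Lemma post_risk_ge0 n alpha X theta : 0 <= alpha <= 1 ->
  (0 <= post_risk n alpha X theta)%E.
Proof.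
move=> a01; apply: iterint_ge0 => [i|eta]; first exact: post_coord_positive.
by rewrite lee_fin; apply: sumr_ge0 => i _; exact: sqr_ge0.
Qed.

End PosteriorRisk.

(** * The score inequalities and the loss on nonzero coordinates *)

Section Score.
Context {R : realType}.
Local Notation phi := (@phi R).
Local Notation gconv := (@gconv R).
Implicit Types (x y a b alpha : R) (X theta : nat -> R).

Definition mixture b x := (1 - b) * phi x + b * gconv x.

Definition score b x : R := (gconv x - phi x) / mixture b x.

Lemma mixture_gt0 b x : 0 <= b <= 1 -> 0 < mixture b x.
Proof. exact: mixture_den_gt0. Qed.

(** The mixtures at b and a have ratio 1 + (b - a) score(a), and ln (1 + y) <= y: concavity without
    differentiating. *)
Lemma loglik_tangent n a b X : 0 <= a <= 1 -> 0 <= b <= 1 ->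
  loglik n b X - loglik n a X <= (b - a) * \sum_(i < n) score a (X i).
Proof.
move=> a01 b01; rewrite /loglik -sumrB mulr_sumr; apply: ler_sum => i _.
have ma := mixture_gt0 (X i) a01; have mb := mixture_gt0 (X i) b01.
rewrite -/(mixture a (X i)) -/(mixture b (X i)) -ln_div ?posrE//.
have E : mixture b (X i) / mixture a (X i) = 1 + (b - a) * score a (X i).
  move: ma; rewrite /score /mixture; move: (phi _) (gconv _) => p g /lt0r_neq0 ma.
  by field; exact: ma.
have : 0 < mixture b (X i) / mixture a (X i) by rewrite divr_gt0.
by rewrite E => h; apply: le_ln1Dx; lra.
Qed.

Lemma mle_score_ge0 n ahat X a : is_mle n ahat -> 0 <= a -> alpha_n R n <= a ->
  a < ahat X -> 0 <= \sum_(i < n) score a (X i).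
Proof.
move=> /(_ X)[/andP[_ h1] mle] a0 an ah.
have h2 : loglik n a X <= loglik n (ahat X) X by apply: mle; rewrite an/=; lra.
have a01 : 0 <= a <= 1 by rewrite a0/=; lra.
have b01 : 0 <= ahat X <= 1 by rewrite h1 andbT; lra.
have h3 := loglik_tangent n X a01 b01.
by rewrite -(@pmulr_rge0 _ (ahat X - a)); lra.
Qed.

Lemma mle_score_le0 n ahat X b : is_mle n ahat -> 0 <= ahat X ->
  ahat X < b -> b <= 1 -> \sum_(i < n) score b (X i) <= 0.
Proof.
move=> /(_ X)[/andP[h0 h1] mle] a0 ab b1.
have h2 : loglik n b X <= loglik n (ahat X) X by apply: mle; rewrite b1 andbT; lra.
have b01 : 0 <= b <= 1 by rewrite b1 andbT; lra.
have a01 : 0 <= ahat X <= 1 by rewrite a0/=; lra.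
have h3 := @loglik_tangent n b (ahat X) X b01 a01.
rewrite -(@nmulr_rge0 _ (ahat X - b)); lra.
Qed.

Definition Cphi : R := 2 / cg.

Lemma phi_le_gconv x : phi x <= Cphi * gconv x.
Proof.
have dx : 0 < 1 + x ^+ 2 by rewrite ltr_pwDl ?sqr_ge0.
have c0 := @cg_gt0 R.
apply: (@le_trans _ _ (Cphi * (cg / (1 + x ^+ 2)))).
  rewrite /Cphi mulrA divfK ?lt0r_neq0//.
  apply: (le_trans (phi_le_expR x)).
  rewrite mulNr expRN ler_pdivlMr// mulrC ler_pdivrMr ?expR_gt0//.
  by have := expR_ge1Dx (x ^+ 2 / 2); lra.
by rewrite ler_pM2l ?gconv_ge// divr_gt0.
Qed.

Definition Cs : R := 1 + Cphi.

Lemma Cphi_gt0 : 0 < Cphi. Proof. by rewrite divr_gt0// cg_gt0. Qed.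

(** The claim amounts to phi <= Cs ((1 - b) phi + b g), which follows on splitting phi as (1 - b)
    phi + b phi and using phi <= Cphi g. *)
Lemma score_lb b x : 0 <= b <= 1 -> gconv x / mixture b x <= score b x + Cs.
Proof.
move=> b01; have m0 := mixture_gt0 x b01; have c0 := Cphi_gt0.
rewrite -(ler_pM2r m0) divfK ?lt0r_neq0// mulrDl divfK ?lt0r_neq0//.
have := phi_le_gconv x; have := phi_gt0 x; have := gconv_gt0 x.
rewrite /Cs /mixture; move: (phi x) (gconv x) Cphi c0 => p g c c0 g0 p0 pc.
case/andP: b01 => b0 b1.
have : 0 <= b * (c * g - p) by rewrite mulr_ge0//; lra.
have : 0 <= c * ((1 - b) * p) by rewrite !mulr_ge0//; lra.
have : 0 <= b * g by rewrite mulr_ge0//; lra.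
lra.
Qed.

(* At least 1 and at least min(gconv x / phi x, 1 / b). *)
Definition Yscore b x : R := 2 * Cs * (score b x + Cs).

(** With q = g / phi, g / mixture = q / (1 - b + b q). The denominator is at most 2 if b q <= 1 and
    at most 2 b q if b q >= 1. *)
Lemma Yscore_lb b x : 0 < b -> b <= 1 ->
  [/\ 1 <= Yscore b x, b * (gconv x / phi x) <= 1 -> gconv x / phi x <= Yscore b x &
      1 <= b * (gconv x / phi x) -> b^-1 <= Yscore b x].
Proof.
move=> b0 b1; have b01 : 0 <= b <= 1 by lra.
have m0 := mixture_gt0 x b01; have c0 := Cphi_gt0.
have Cs0 : 0 < Cs by rewrite /Cs; lra.
have Yg : 2 * Cs * (gconv x / mixture b x) <= Yscore b x.
  by rewrite ler_pM2l ?score_lb// mulr_gt0.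
have := phi_le_gconv x; have p0 := phi_gt0 x; have g0 := gconv_gt0 x => pg.
have [q q0 gq] : exists2 q, 0 < q & gconv x = q * phi x.
  by exists (gconv x / phi x); [rewrite divr_gt0|rewrite divfK ?lt0r_neq0].
move: Yg m0 pg; rewrite /mixture gq mulfK ?lt0r_neq0// /Cs.
move: (phi x) Cphi (Yscore b x) p0 c0 => p c Y p0 c0 Yg m0 pg.
have qp : 0 < q * p by rewrite mulr_gt0.
split.
- apply: le_trans Yg; rewrite mulrA ler_pdivlMr// mul1r.
  have : b * (q * p) <= q * p by rewrite ler_piMl// ltW.
  have : b * p >= 0 by rewrite mulr_ge0// ltW.
  have : 0 <= c * (q * p) by rewrite mulr_ge0// ltW.
  lra.
- move=> bq; apply: le_trans Yg; rewrite mulrA ler_pdivlMr//.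
  have : q * p * (1 - b + b * q) <= q * p * 2 by rewrite ler_pM2l//; lra.
  have : 0 <= c * (q * p) by rewrite mulr_ge0// ltW.
  lra.
- move=> bq; apply: le_trans Yg; rewrite mulrA ler_pdivlMr// -ler_pdivlMl ?invr_gt0//.
  rewrite invrK.
  have : p * 1 <= p * (b * q) by rewrite ler_pM2l.
  have : b * p >= 0 by rewrite mulr_ge0// ltW.
  have : 0 <= c * (b * (q * p)) by rewrite mulr_ge0 ?mulr_ge0// ltW.
  lra.
Qed.

Definition Kx : R := `|4 * ln (4 / cg)|.

(** The ratio g / phi is at least a constant times exp(x^2 / 4), half of the exponent having
    absorbed 1 + x^2. *)
Lemma sqr_le_ln x : x ^+ 2 <= Kx + 4 * ln (gconv x / phi x).
Proof.
have dx : 0 < 1 + x ^+ 2 by rewrite ltr_pwDl ?sqr_ge0.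
have c0 := @cg_gt0 R; have p0 := phi_gt0 x; have g0 := gconv_gt0 x.
have h : cg / 4 * expR (x ^+ 2 / 4) <= gconv x / phi x.
  rewrite ler_pdivlMr//.
  apply: (@le_trans _ _ (cg / 4 * expR (x ^+ 2 / 4) * expR (- (x ^+ 2) / 2))).
    have e0 : 0 <= cg / 4 * expR (x ^+ 2 / 4) by rewrite ltW// mulr_gt0 ?expR_gt0//; lra.
    by apply: ler_wpM2l => //; exact: phi_le_expR.
  apply: le_trans (gconv_ge x).
  rewrite -mulrA -expRD.
  have -> : x ^+ 2 / 4 + - (x ^+ 2) / 2 = - (x ^+ 2 / 4) by field.
  rewrite expRN -mulrA ler_pM2l// -invfM lef_pV2 ?posrE ?mulr_gt0 ?expR_gt0//.
  by have := expR_ge1Dx (x ^+ 2 / 4); lra.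
have c4 : 0 < cg / 4 :> R by lra.
have : ln (cg / 4 * expR (x ^+ 2 / 4)) <= ln (gconv x / phi x).
  rewrite ler_ln// posrE; first exact: mulr_gt0 (expR_gt0 _).
  exact: divr_gt0.
rewrite lnM ?posrE ?expR_gt0// expRK.
have -> : ln (cg / 4) = - ln (4 / cg) :> R.
  by rewrite -lnV; [rewrite invf_div|rewrite posrE divr_gt0].
have := ler_norm (4 * ln (4 / cg) : R); rewrite -/Kx; lra.
Qed.

(** If b g / phi <= 1, then g / phi <= Y and [sqr_le_ln] suffices. Otherwise ln (g / phi) splits as
    ln (alpha g / phi) - ln alpha: the weight w of the atom satisfies w alpha g / phi <= 1, which
    controls the first part, and 1 / b <= Y controls the second. *)
Lemma weighted_sqr_le b alpha x M1 M2 : 0 < b -> b <= 1 -> 0 < alpha -> alpha <= 1 ->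
  0 <= M1 -> 1 <= M2 -> - ln alpha <= M1 - M2 * ln b ->
  (1 - apost alpha x) * x ^+ 2 <= Kx + 4 + 4 * M1 + 4 * M2 * ln (Yscore b x).
Proof.
move=> b0 b1 a0 a1 M10 M21 ab.
have [Y1 Yr Yb] := Yscore_lb x b0 b1.
have a01 : 0 <= alpha <= 1 by lra.
have p0 := phi_gt0 x; have g0 := gconv_gt0 x.
have r0 : 0 < gconv x / phi x by rewrite divr_gt0.
have w0 := apostC_ge0 x a01.
have w1 : 1 - apost alpha x <= 1 by have := apost_ge0 x a01; lra.
have war : (1 - apost alpha x) * (alpha * (gconv x / phi x)) <= 1.
  have m0 := mixture_gt0 x a01; rewrite apostC// -/(mixture alpha x).
  rewrite [leLHS](_ : _ = (1 - alpha) * (alpha * gconv x) / mixture alpha x); last first.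
    by field; rewrite !lt0r_neq0.
  rewrite ler_pdivrMr// mul1r /mixture.
  have : 0 <= (1 - alpha) * phi x by rewrite mulr_ge0 ?phi_ge0//; lra.
  have : 0 <= alpha * (alpha * gconv x) by rewrite !mulr_ge0// ltW.
  lra.
have lnY : 0 <= ln (Yscore b x) by rewrite ln_ge0.
have M2Y : ln (Yscore b x) <= M2 * ln (Yscore b x) by rewrite ler_peMl.
have xr := sqr_le_ln x.
have x2 := sqr_ge0 x.
have K0 : 0 <= Kx by rewrite normr_ge0.
have w2 : (1 - apost alpha x) * x ^+ 2 <= x ^+ 2 by rewrite ler_piMl.
case: (leP (b * (gconv x / phi x)) 1) => [/Yr h|/ltW/Yb h].
  have : ln (gconv x / phi x) <= ln (Yscore b x).
    by rewrite ler_ln ?posrE//; lra.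
  lra.
have hb : - ln b <= ln (Yscore b x).
  by rewrite -lnV ?posrE// ler_ln ?posrE ?invr_gt0//; lra.
have e : ln (gconv x / phi x) = ln (alpha * (gconv x / phi x)) - ln alpha.
  by rewrite [ln (alpha * _)]lnM ?posrE//; ring.
have s1 : ln (alpha * (gconv x / phi x)) <= alpha * (gconv x / phi x).
  by apply/ltW/ln_sublinear; rewrite mulr_gt0.
have la : ln alpha <= 0 by rewrite ln_le0.
rewrite e in xr.
have MY : M2 * - ln b <= M2 * ln (Yscore b x) by rewrite ler_wpM2l//; lra.
move: w0 w1 war s1 xr w2; move: (1 - apost alpha x) => w.
move: (ln (alpha * _)) => l; move: (alpha * (gconv x / phi x)) => y.
move=> w0 w1 war s1 xr w2.
have : w * x ^+ 2 <= w * (Kx + 4 * (l - ln alpha)) by rewrite ler_wpM2l.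
have : w * l <= w * y by rewrite ler_wpM2l.
have : w * Kx <= Kx by rewrite ler_piMl.
have : w * - ln alpha <= - ln alpha by rewrite ler_piMl//; lra.
lra.
Qed.

(** Concavity in the form ln Y <= ln (n / s) + Y s / n, summed over at most s signals. *)
Lemma sum_weighted_sqr_le n s b alpha X theta M1 M2 :
  0 < b -> b <= 1 -> 0 < alpha -> alpha <= 1 ->
  0 <= M1 -> 1 <= M2 -> - ln alpha <= M1 - M2 * ln b ->
  1 <= s -> s <= n%:R -> in_l0 n s theta ->
  \sum_(i < n) score b (X i) <= 0 ->
  \sum_(i < n | theta i != 0) (1 - apost alpha (X i)) * X i ^+ 2 <=
  s * (Kx + 4 + 4 * M1) + 4 * M2 * (s * ln (n%:R / s) + 2 * Cs ^+ 2 * s).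
Proof.
move=> b0 b1 a0 a1 M10 M21 ab s1 sn th sc.
have n0 : 0 < n%:R :> R by lra.
have r0 : 0 < n%:R / s by rewrite divr_gt0//; lra.
have L0 : 0 <= ln (n%:R / s) by rewrite ln_ge0// ler_pdivlMr//; lra.
have K0 : 0 <= Kx by rewrite normr_ge0.
have Cs0 : 0 < Cs by rewrite /Cs; have := Cphi_gt0; lra.
have card : \sum_(i < n | theta i != 0) 1 <= s.
  rewrite (le_trans _ th)// sumr_const ler_nat.
  by apply/subset_leq_card/fintype.subsetP => i; rewrite !inE.
apply: (@le_trans _ _ (\sum_(i < n | theta i != 0)
    ((Kx + 4 + 4 * M1 + 4 * M2 * ln (n%:R / s)) +
     4 * M2 * (Yscore b (X i) / (n%:R / s))))).
  apply: ler_sum => i _.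
  apply: le_trans (weighted_sqr_le (X i) b0 b1 a0 a1 M10 M21 ab) _.
  have [Y1 _ _] := Yscore_lb (X i) b0 b1.
  have : ln (Yscore b (X i) / (n%:R / s)) <= Yscore b (X i) / (n%:R / s).
    by apply/ltW/ln_sublinear; rewrite divr_gt0//; lra.
  rewrite ln_div ?posrE//; last lra.
  move: (ln (Yscore _ _)) (_ / (_ / s)) (ln (n%:R / s)) => y z w yz.
  have : M2 * (y - w) <= M2 * z by rewrite ler_wpM2l//; lra.
  lra.
rewrite big_split/= -mulr_sumr.
have : \sum_(i < n | theta i != 0) Yscore b (X i) / (n%:R / s) <=
   2 * Cs ^+ 2 * s.
  (* As Y >= 1 everywhere, the sum may be extended to all coordinates, where the sign of the total
     score applies. *)
  apply: (@le_trans _ _ (\sum_(i < n) Yscore b (X i) / (n%:R / s))).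
    rewrite [leRHS](bigID (fun i : 'I_n => theta i != 0))/= lerDl.
    apply: sumr_ge0 => i _; have [Y1 _ _] := Yscore_lb (X i) b0 b1.
    by rewrite divr_ge0//; lra.
  rewrite -mulr_suml ler_pdivrMr//.
  rewrite [leRHS](_ : _ = 2 * Cs ^+ 2 * n%:R); last by field; lra.
  rewrite /Yscore -mulr_sumr big_split/= sumr_const card_ord -mulr_natr.
  rewrite expr2; have : 2 * Cs * \sum_(i < n) score b (X i) <= 0.
    by rewrite pmulr_rle0// mulr_gt0.
  lra.
have : \sum_(i < n | theta i != 0) (Kx + 4 + 4 * M1 + 4 * M2 * ln (n%:R / s)) <=
    s * (Kx + 4 + 4 * M1 + 4 * M2 * ln (n%:R / s)).
  rewrite -[X in \sum_(i < n | _) X]mul1r -mulr_suml ler_wpM2r//.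
  have : 0 <= M2 * ln (n%:R / s) by rewrite mulr_ge0//; lra.
  lra.
move: (\sum_(i < n | _) (_ / _)) => Z ZY H.
have : M2 * Z <= M2 * (2 * Cs ^+ 2 * s) by rewrite ler_wpM2l//; lra.
lra.
Qed.

End Score.

(** * One-coordinate expectations under the data law *)

Section Expectations.
Context {R : realType}.
Local Notation leb := (@lebesgue_measure R).
Local Notation phi := (@phi R).
Local Notation gconv := (@gconv R).
Implicit Types (x y a b z alpha lam : R) (theta : nat -> R).

Lemma measurable_fun_inv_pos (f : R -> R) : (forall x, 0 < f x) ->
  measurable_fun [set: R] f -> measurable_fun [set: R] (fun x => (f x)^-1).
Proof.
move=> f0 mf; rewrite (_ : (fun x => _) = (fun x => expR (- ln (f x)))).
  apply: measurableT_comp => //; apply: measurableT_comp => //.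
  by apply: measurableT_comp => //; exact: measurable_ln.
by apply/funext => x; rewrite expRN lnK ?posrE.
Qed.

Lemma measurable_mixture b : measurable_fun [set: R] (mixture b).
Proof.
apply: measurable_funD; apply: measurable_funM => //.
  exact: measurable_phi.
exact: measurable_gconv.
Qed.

Lemma measurable_score b : 0 <= b <= 1 -> measurable_fun [set: R] (score b).
Proof.
move=> b01; apply: measurable_funM.
  by apply: measurable_funB; [exact: measurable_gconv|exact: measurable_phi].
apply: measurable_fun_inv_pos; last exact: measurable_mixture.
by move=> x; exact: mixture_gt0.
Qed.

Lemma measurable_apost b : 0 <= b <= 1 -> measurable_fun [set: R] (apost b).
Proof.
move=> b01; apply: measurable_funM.
  by apply: measurable_funM => //; exact: measurable_gconv.
apply: measurable_fun_inv_pos; last exact: measurable_mixture.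
by move=> x; exact: mixture_gt0.
Qed.

Definition Cv : R := 16 ^+ 2 * Num.sqrt (8 * pi).

Lemma Cv_gt0 : 0 < Cv.
Proof. by apply: mulr_gt0; rewrite ?exprn_gt0// sqrtr_gt0 mulr_gt0// pi_gt0. Qed.

Lemma data_coord_poly theta i c : 0 <= c ->
  (data_coord theta i (EFin \o (fun x => c * (1 + (x - theta i) ^+ 2))%R) <= (c * Cv)%:E)%E.
Proof.
move=> c0; rewrite /data_coord.
have q0 : 0 <= 16 ^+ 2 :> R by rewrite exprn_ge0.
apply: (@le_trans _ _ (\int[leb]_x ((c * 16 ^+ 2)%:E * (bell (x - theta i))%:E))%E).
  apply: le_integral_ge0 => x; rewrite -EFinM lee_fin.
    by rewrite !mulr_ge0 ?phi_ge0// addr_ge0 ?sqr_ge0.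
  rewrite -[leLHS]mulrA -[leRHS]mulrA ler_wpM2l//; apply: le_trans (poly_phi_le_bell _).
  rewrite expr2 -mulrA ler_peMl// ?lerDl ?sqr_ge0//.
  by rewrite mulr_ge0 ?phi_ge0// addr_ge0 ?sqr_ge0.
rewrite ge0_integralZl_EFin//.
- by rewrite integral_bell -EFinM lee_fin /Cv [leRHS]mulrA.
- by move=> x _; rewrite lee_fin expR_ge0.
- by apply/measurable_EFinP; exact: measurable_bell.
- by rewrite mulr_ge0.
Qed.

Lemma apost_phi_le alpha x : 0 <= alpha -> alpha <= 2^-1 ->
  apost alpha x * phi x <= 2 * alpha * gconv x.
Proof.
move=> a0 a1; have a01 : 0 <= alpha <= 1 by rewrite a0/=; lra.
have m0 := mixture_gt0 x a01; have p0 := phi_gt0 x; have g0 := gconv_gt0 x.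
rewrite /apost -/(mixture alpha x) mulrAC ler_pdivrMr//.
rewrite [leRHS](_ : _ = alpha * gconv x * (2 * mixture alpha x)); last by ring.
rewrite ler_wpM2l ?mulr_ge0// ?(ltW g0)// /mixture.
have : 0 <= alpha * gconv x by rewrite mulr_ge0// ltW.
have : 0 <= (2^-1 - alpha) * phi x by rewrite mulr_ge0 ?phi_ge0//; lra.
lra.
Qed.

Definition Ca : R := 4 * Cg + 8 * Num.sqrt (8 * pi).

(** The exponent x^2 / 2 is shared: 1/8 absorbs the polynomial, 1/4 gives the tail in z, 1/8 remains
    integrable. *)
Lemma poly_phi_tail x z : 0 <= z -> z < `|x| ->
  (1 + x ^+ 2) * phi x <= 8 * expR (- (z ^+ 2 / 4)) * bell x.
Proof.
move=> z0 zx.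
have : z ^+ 2 <= x ^+ 2 by rewrite -[x ^+ 2]real_normK ?num_real// lerXn2r// ?nnegrE ltW.
move=> zx2; apply: (@le_trans _ _ (8 * expR (x ^+ 2 / 8) * expR (- (x ^+ 2) / 2))).
  apply: ler_pM; rewrite ?phi_ge0 ?phi_le_expR ?addr_ge0 ?sqr_ge0//.
  by have := expR_ge1Dx (x ^+ 2 / 8); have := sqr_ge0 x; lra.
by rewrite /bell -!mulrA ler_pM2l// -!expRD ler_expR; lra.
Qed.

(** For |x| <= z, a(x) phi <= 2 alpha g and g (1 + x^2) is bounded, so the interval length gives
    alpha z. For |x| > z, a(x) <= 1 and the Gaussian tail is used. *)
Lemma data_coord_apost theta i alpha z : theta i = 0 -> 0 <= alpha ->
  alpha <= 2^-1 -> 0 <= z ->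
  (data_coord theta i (EFin \o (fun x => apost alpha x * (1 + x ^+ 2))%R) <=
   (Ca * (alpha * z + expR (- (z ^+ 2 / 4))))%:E)%E.
Proof.
move=> ti a0 a1 z0; have a01 : 0 <= alpha <= 1 by rewrite a0/=; lra.
have C0 := @Cg_gt0 R.
set w := expR (- (z ^+ 2 / 4)); have w0 : 0 <= w by exact: expR_ge0.
rewrite /data_coord ti.
apply: (@le_trans _ _ (\int[leb]_x ((2 * alpha * Cg)%:E * (\1_`[(- z)%R, z] x)%:E +
    (8 * w)%:E * (bell (x - 0))%:E))%E).
  apply: le_integral_ge0 => x; rewrite -?EFinM -?EFinD lee_fin ?subr0.
    apply: mulr_ge0 (phi_ge0 _); apply: mulr_ge0; first exact: apost_ge0.
    by rewrite addr_ge0 ?sqr_ge0.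
  have b0 : 0 <= 8 * w * bell x by rewrite !mulr_ge0// expR_ge0.
  have dx : 0 < 1 + x ^+ 2 by rewrite ltr_pwDl ?sqr_ge0.
  rewrite indicE; case: (boolP (x \in _)) => [xz|].
    rewrite mulr1 -[leLHS]addr0 lerD//.
    rewrite mulrAC; apply: (@le_trans _ _ (2 * alpha * gconv x * (1 + x ^+ 2))).
      by rewrite ler_pM2r// apost_phi_le.
    rewrite -mulrA ler_wpM2l ?mulr_ge0//.
    by rewrite -ler_pdivlMr// gconv_le.
  rewrite mulr0 add0r notin_setE/= in_itv/= => /negP; rewrite -ler_norml -ltNge => zx.
  apply: le_trans (poly_phi_tail z0 zx).
  rewrite -mulrA ler_piMl ?mulr_ge0 ?phi_ge0 ?(ltW dx)//.
  by have := apostC_ge0 x a01; lra.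
have mb := @measurable_bell R 0.
rewrite ge0_integralD//; last 4 first.
- by move=> x _; rewrite -EFinM lee_fin !mulr_ge0// ltW.
- by apply/measurable_EFinP; apply: measurable_funM => //; exact: measurable_indic.
- by move=> x _; rewrite -EFinM lee_fin !mulr_ge0// expR_ge0.
- by apply/measurable_EFinP; exact: measurable_funM.
rewrite !ge0_integralZl_EFin//; last 5 first.
- by move=> x _; rewrite lee_fin expR_ge0.
- exact/measurable_EFinP.
- by rewrite mulr_ge0.
- by apply/measurable_EFinP; exact: measurable_indic.
- by rewrite !mulr_ge0// ltW.
rewrite integral_bell integral_indic//= setIT lebesgue_measure_itv/= lte_fin.
have -> : (if (- z < z)%R then (z%:E - (- z)%:E)%E else 0%E) = (2 * z)%:E :> \bar R.
  case: ltP => [_|zz]; first by rewrite -EFinB; congr EFin; ring.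
  by congr EFin; lra.
rewrite -!EFinM -EFinD lee_fin /Ca.
have : 0 <= Num.sqrt (8 * pi) * (alpha * z) :> R by rewrite !mulr_ge0.
have : 0 <= Cg * w by rewrite mulr_ge0// ltW.
clearbody w; move: (Num.sqrt _) Cg => k C; lra.
Qed.

Lemma score_ub b x : 0 < b -> b <= 1 -> score b x <= b^-1.
Proof.
move=> b0 b1; have m0 : 0 < mixture b x by apply: mixture_gt0; rewrite ltW.
have p0 := phi_gt0 x.
rewrite /score ler_pdivrMr// mulrC ler_pdivlMr// /mixture.
have : 0 <= (1 - b) * phi x by rewrite mulr_ge0 ?(ltW p0)//; lra.
have : 0 < b * phi x by rewrite mulr_gt0.
lra.
Qed.

Lemma data_coord_exp_score theta i alpha lam : 0 < alpha -> alpha <= 1 -> 0 <= lam ->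
  (data_coord theta i (EFin \o (fun x => expR (lam * score alpha x))) <=
   (expR (lam / alpha))%:E)%E.
Proof.
move=> a0 a1 l0.
apply: (@le_trans _ _ (\int[leb]_x ((expR (lam / alpha))%:E * (phi (x - theta i))%:E))%E).
  apply: le_integral_ge0 => x; rewrite -EFinM lee_fin.
    by rewrite mulr_ge0 ?expR_ge0 ?phi_ge0.
  by rewrite ler_wpM2r ?phi_ge0// ler_expR ler_wpM2l// score_ub.
rewrite ge0_integralZl_EFin//.
- by rewrite integral_phi mule1.
- by move=> x _; rewrite lee_fin phi_ge0.
- by apply/measurable_EFinP; exact: measurable_phi_shift.
Qed.

(** From exp y <= 1 / (1 - y), since (1 + y + 2 y^2) (1 - y) = 1 + y^2 (1 - 2 y). *)
Lemma expR_le_quad y : y <= 2^-1 -> expR y <= 1 + y + 2 * y ^+ 2.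
Proof.
move=> y1; have h : 0 < 1 - y by lra.
have : (1 - y) * expR y <= 1.
  have := expR_ge1Dx (- y); rewrite -(ler_pM2r (expR_gt0 y)) -expRD addNr expR0; lra.
rewrite mulrC -ler_pdivlMr// => /le_trans; apply.
rewrite ler_pdivrMr//.
have : 0 <= y ^+ 2 * (1 - 2 * y) by rewrite mulr_ge0 ?sqr_ge0//; lra.
lra.
Qed.

Lemma exp_score_le2 alpha lam x : 0 < alpha -> alpha <= 1 -> 0 <= lam -> lam <= alpha / 2 ->
  expR (lam * score alpha x) <= 2.
Proof.
move=> a0 a1 l0 la.
apply: (@le_trans _ _ (expR (2^-1))).
  rewrite ler_expR; apply: (@le_trans _ _ (lam / alpha)).
    by rewrite ler_wpM2l// score_ub.
  by rewrite ler_pdivrMr//; lra.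
apply: le_trans (expR_le_quad (lexx _)) _; lra.
Qed.

Lemma data_coord_poly_exp theta i alpha lam : theta i = 0 -> 0 < alpha -> alpha <= 1 ->
  0 <= lam -> lam <= alpha / 2 ->
  (data_coord theta i (EFin \o (fun x => (1 + x ^+ 2) * expR (lam * score alpha x))%R) <=
   (2 * Cv)%:E)%E.
Proof.
move=> ti a0 a1 l0 la.
have := @data_coord_poly theta i 2 (ler0n R 2).
apply: le_trans; have [_ + _] := data_coord_positive theta i; apply.
  by move=> x; rewrite lee_fin mulr_ge0 ?expR_ge0// addr_ge0 ?sqr_ge0.
move=> x; rewrite lee_fin ti subr0 mulrC ler_wpM2r ?addr_ge0 ?sqr_ge0//.
exact: exp_score_le2.
Qed.

(* score * phi = (gconv - phi) - alpha (gconv - phi)^2 / mixture, and the first term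
   integrates to 0: the drift of the score comes from the square, which is at least
   gconv / 8 on [z, 2 z]. *)
Lemma exp_score_pointwise alpha lam z x : 0 < alpha -> alpha <= 2^-1 -> 0 <= lam ->
  lam <= alpha / 2 -> (forall y, z <= y -> phi y <= alpha * gconv y) ->
  expR (lam * score alpha x) * phi x +
    (lam * phi x + lam / 8 * (gconv x * \1_`[z, (2 * z)%R] x)) <=
  (1 + 4 * lam ^+ 2 / alpha) * phi x + (lam + 4 * lam ^+ 2 / alpha) * gconv x.
Proof.
move=> a0 a1 l0 la tail; have p0 := phi_gt0 x; have g0 := gconv_gt0 x.
have a1' : alpha <= 1 by lra.
have m0 : 0 < mixture alpha x by apply: mixture_gt0; rewrite ltW.
have mE : mixture alpha x = (1 - alpha) * phi x + alpha * gconv x by [].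
have ai : 2 <= alpha^-1 by rewrite -[2]invrK lef_pV2// posrE.
have mp : phi x <= 2 * mixture alpha x.
  have : 0 < alpha * gconv x by rewrite mulr_gt0.
  have : 0 <= (2^-1 - alpha) * phi x by rewrite mulr_ge0 ?phi_ge0//; lra.
  by rewrite mE; lra.
have sE : score alpha x * mixture alpha x = gconv x - phi x.
  by rewrite /score divfK// lt0r_neq0.
have sub := score_ub x a0 a1'.
have slb : - alpha^-1 <= score alpha x.
  apply: (@le_trans _ _ (- 2)); first lra.
  by rewrite -(ler_pM2r m0) sE; lra.
have q : expR (lam * score alpha x) * phi x <=
    (1 + lam * score alpha x + 2 * (lam * score alpha x) ^+ 2) * phi x.
  rewrite ler_wpM2r ?(ltW p0)// expR_le_quad//.
  apply: (@le_trans _ _ (lam * alpha^-1)); first by rewrite ler_wpM2l.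
  by rewrite ler_pdivrMr//; lra.
set s := score alpha x in sE sub slb q *; set m := mixture alpha x in m0 mE mp sE.
set g := gconv x in g0 mE sE *; set p := phi x in p0 mE mp sE q *.
have pE : p = m - alpha * (s * m) by rewrite sE mE; ring.
have sp : s * p = (g - p) - alpha * (s ^+ 2 * m).
  by rewrite {1}pE -sE; ring.
(* One factor |s| is at most 1 / alpha; the other is paired with p <= 2 m, using |s| m <= g + p. *)
have s2p : s ^+ 2 * p <= 2 / alpha * (g + p).
  have sn : `|s| <= alpha^-1 by rewrite ler_norml slb sub.
  have sm : `|s| * m <= g + p.
    by rewrite -{1}(ger0_norm (ltW m0)) -normrM sE ler_norml; lra.
  rewrite -(real_normK (num_real s)).
  have s0 := normr_ge0 s; move: (`|s|) s0 sn sm => A A0 An Am.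
  have : A * (A * p) <= alpha^-1 * (A * (2 * m)).
    apply: ler_pM => //; first by rewrite mulr_ge0// ltW.
    by rewrite ler_wpM2l.
  have : alpha^-1 * (A * m) <= alpha^-1 * (g + p) by rewrite ler_wpM2l// invr_ge0 ltW.
  lra.
have neg : (g * \1_`[z, (2 * z)%R] x) / 8 <= alpha * (s ^+ 2 * m).
  have N0 : 0 <= alpha * (s ^+ 2 * m).
    by rewrite mulr_ge0 ?(ltW a0)// mulr_ge0 ?sqr_ge0// ltW.
  rewrite indicE; case: (boolP (x \in _)) => [|_]; last by rewrite mulr0 mul0r.
  rewrite inE/= in_itv/= => /andP[zx _].
  have pt : p <= alpha * g := tail x zx.
  have ag : alpha * g <= 2^-1 * g by rewrite ler_pM2r.
  (* Beyond z, p <= alpha g <= g / 2, so g - p >= g / 2 and m <= 2 alpha g; the quotient alpha (g /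
     2)^2 / (2 alpha g) is g / 8. *)
  rewrite mulr1 -(ler_pM2r m0).
  have -> : alpha * (s ^+ 2 * m) * m = alpha * (g - p) ^+ 2 by rewrite -sE; ring.
  have h1 : (g / 2) ^+ 2 <= (g - p) ^+ 2 by rewrite lerXn2r// ?nnegrE; lra.
  have h2 : alpha * (g / 2) ^+ 2 <= alpha * (g - p) ^+ 2 by rewrite ler_pM2l.
  have h3 : g * m <= g * (2 * (alpha * g)).
    rewrite ler_pM2l// mE; have : 0 <= alpha * p by rewrite mulr_ge0// ltW.
    lra.
  lra.
have l2 : lam ^+ 2 * (s ^+ 2 * p) <= lam ^+ 2 * (2 / alpha * (g + p)).
  by rewrite ler_wpM2l ?sqr_ge0.
have lN : lam * ((g * \1_`[z, (2 * z)%R] x) / 8) <= lam * (alpha * (s ^+ 2 * m)).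
  by rewrite ler_wpM2l.
have lsp : lam * (s * p) = lam * (g - p) - lam * (alpha * (s ^+ 2 * m)).
  by rewrite sp; ring.
move: (expR _ * p) (\1__ x) q lN l2 lsp => E I q lN l2 lsp.
rewrite [leRHS](_ : _ = p + lam * g + 2 * (lam ^+ 2 * (2 / alpha * (g + p)))); last by ring.
lra.
Qed.

(** The factor 40 is 8 times 5: the 1/8 of [exp_score_pointwise], and the lower bound cg / (5 z) for
    the mass of [gconv] on [z, 2 z]. *)
Definition kap : R := cg / 40.

Lemma kap_gt0 : 0 < kap. Proof. by apply: divr_gt0; [exact: cg_gt0|]. Qed.

Lemma cg_le1 : cg <= 1 :> R.
Proof.
have pi2 := @pi_ge2 R; have p1 : phi 1 <= 1.
  by apply: le_trans (phi_le_expR 1) _; rewrite expR_le1 expr1n; lra.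
rewrite /cg ler_pdivrMr; lra.
Qed.

(* The rate kap alpha / (16 z) balances the drift of the score, of order 1 / z,
   against its second moment, of order 1 / alpha. *)
Lemma data_coord_exp_score_null theta i alpha z : theta i = 0 -> 0 < alpha ->
  alpha <= 2^-1 -> 1 <= z -> (forall y, z <= y -> phi y <= alpha * gconv y) ->
  (data_coord theta i (EFin \o (fun x => expR (kap * alpha / (16 * z) * score alpha x))) <=
   (expR (- (kap ^+ 2 * alpha / (32 * z ^+ 2))))%:E)%E.
Proof.
move=> ti a0 a1 z1 tail; set lam := kap * alpha / (16 * z).
have k0 := kap_gt0; have k1 : kap <= 1 by rewrite /kap; have := cg_le1; have := @cg_gt0 R; lra.
have z0 : 0 < z by lra.
have l0 : 0 < lam by rewrite /lam; apply: divr_gt0; apply: mulr_gt0 => //; lra.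
have la : lam <= alpha / 2.
  rewrite /lam ler_pdivrMr; last by lra.
  have : kap * alpha <= 1 * alpha by rewrite ler_pM2r.
  have : alpha * 1 <= alpha * z by rewrite ler_pM2l.
  lra.
have a01 : 0 <= alpha <= 1 by lra.
rewrite /data_coord ti.
set E := (\int[leb]_x _)%E.
pose I x := gconv x * \1_`[z, (2 * z)%R] x.
have I0 x : 0 <= I x by rewrite mulr_ge0// ltW// gconv_gt0.
have mI : measurable_fun [set: R] I.
  by apply: measurable_funM; [exact: measurable_gconv|exact: measurable_indic].
have mp : measurable_fun [set: R] phi := measurable_phi.
have mg := @measurable_gconv R.
have iphi : (\int[leb]_x (phi x)%:E = 1)%E.
  by rewrite -(integral_phi 0); apply: eq_integral => x _; rewrite subr0.
have ms : measurable_fun [set: R] (fun x => expR (lam * score alpha x) * phi x).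
  apply: measurable_funM mp; apply: measurableT_comp => //; apply: measurable_funM => //.
  exact: measurable_score.
have Il : ((cg / (5 * z))%:E <= \int[leb]_x (I x)%:E)%E.
  have := @le_integral_interval R [set: R] I z (2 * z) (cg / (1 + (2 * z) ^+ 2)).
  have d0 : 0 < 1 + (2 * z) ^+ 2 by rewrite ltr_pwDl ?sqr_ge0.
  have c0 := @cg_gt0 R.
  have h : cg / (5 * z) <= cg / (1 + (2 * z) ^+ 2) * (2 * z - z).
    rewrite -mulrA ler_pM2l// [leRHS]mulrC ler_pdivlMr// mulrC ler_pdivrMr; last lra.
    have : 1 <= z ^+ 2 by rewrite exprn_ege1.
    lra.
  move=> H; apply: (@le_trans _ _ (cg / (1 + (2 * z) ^+ 2) * (2 * z - z))%:E).
    by rewrite lee_fin.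
  apply: H => //.
  - lra.
  - by rewrite divr_ge0 ?ltW.
  - move=> x /andP[zx xz]; rewrite /I indicE mem_set ?mulr1; last by rewrite /= in_itv/= zx.
    apply: le_trans (gconv_ge x); rewrite ler_pM2l// lef_pV2 ?posrE ?ltr_pwDl ?sqr_ge0//.
    by rewrite lerD2l lerXn2r// nnegrE; lra.
have key : (E + (lam%:E + (lam / 8)%:E * \int[leb]_x (I x)%:E) <=
    (1 + 4 * lam ^+ 2 / alpha)%:E + (lam + 4 * lam ^+ 2 / alpha)%:E)%E.
  have -> : E = (\int[leb]_x (expR (lam * score alpha x) * phi x)%:E)%E.
    by apply: eq_integral => x _; rewrite subr0 -EFinM.
  have q0 : 0 <= 4 * lam ^+ 2 / alpha.
    by rewrite divr_ge0 ?(ltW a0)// mulr_ge0 ?sqr_ge0.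
  have -> : (lam%:E + (lam / 8)%:E * \int[leb]_x (I x)%:E =
     \int[leb]_x (lam * phi x + lam / 8 * I x)%:E)%E.
    under [RHS]eq_integral do rewrite EFinD.
    rewrite ge0_integralD//; last 4 first.
    - by move=> x _; rewrite lee_fin mulr_ge0 ?phi_ge0// ltW.
    - by apply/measurable_EFinP; exact: measurable_funM.
    - by move=> x _; rewrite lee_fin mulr_ge0// divr_ge0// ltW.
    - by apply/measurable_EFinP; exact: measurable_funM.
    under eq_integral do rewrite EFinM.
    rewrite ge0_integralZl_EFin//; last 3 first.
    - by move=> x _; rewrite lee_fin phi_ge0.
    - exact/measurable_EFinP.
    - exact: ltW.
    rewrite iphi mule1; congr (_ + _)%E.
    under [RHS]eq_integral do rewrite EFinM.
    rewrite ge0_integralZl_EFin//.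
    - by move=> x _; rewrite lee_fin.
    - exact/measurable_EFinP.
    - by rewrite divr_ge0// ltW.
  have -> : ((1 + 4 * lam ^+ 2 / alpha)%:E + (lam + 4 * lam ^+ 2 / alpha)%:E =
     \int[leb]_x ((1 + 4 * lam ^+ 2 / alpha) * phi x +
                   (lam + 4 * lam ^+ 2 / alpha) * gconv x)%:E)%E.
    under [RHS]eq_integral do rewrite EFinD.
    rewrite ge0_integralD//; last 4 first.
    - by move=> x _; rewrite lee_fin mulr_ge0 ?phi_ge0// addr_ge0.
    - by apply/measurable_EFinP; exact: measurable_funM.
    - by move=> x _; rewrite lee_fin mulr_ge0 ?(ltW (gconv_gt0 _))// addr_ge0// ltW.
    - by apply/measurable_EFinP; exact: measurable_funM.
    under eq_integral do rewrite EFinM.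
    rewrite ge0_integralZl_EFin//; last 3 first.
    - by move=> x _; rewrite lee_fin phi_ge0.
    - exact/measurable_EFinP.
    - by rewrite addr_ge0.
    rewrite iphi mule1; congr (_ + _)%E.
    under [RHS]eq_integral do rewrite EFinM.
    rewrite ge0_integralZl_EFin ?integral_gconv ?mule1//.
    - by move=> x _; rewrite lee_fin ltW// gconv_gt0.
    - exact/measurable_EFinP.
    - by rewrite addr_ge0// ltW.
  rewrite -ge0_integralD//; last 4 first.
  - by move=> x _; rewrite lee_fin mulr_ge0 ?expR_ge0 ?phi_ge0.
  - exact/measurable_EFinP.
  - move=> x _; rewrite lee_fin addr_ge0// mulr_ge0 ?phi_ge0 ?(ltW l0)//.
    by rewrite divr_ge0// ltW.
  - apply/measurable_EFinP; apply: measurable_funD; exact: measurable_funM.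
  apply: le_integral_ge0 => x; rewrite -EFinD lee_fin.
    apply: addr_ge0; first by rewrite mulr_ge0 ?expR_ge0 ?phi_ge0.
    apply: addr_ge0; apply: mulr_ge0; rewrite ?phi_ge0 ?(ltW l0)//.
    by rewrite divr_ge0// ltW.
  exact: exp_score_pointwise (ltW l0) la tail.
(* The two second-order terms total lam kap / (2 z), half of the drift lam kap / z; the other half
   survives. *)
have lc : 4 * lam ^+ 2 / alpha = lam * (kap / (4 * z)).
  by rewrite /lam; field; rewrite !gt_eqF.
have lI : lam / 8 * (cg / (5 * z)) = lam * (kap / z).
  by rewrite /kap; field; rewrite gt_eqF.
have E1 : (E <= (1 - lam * (kap / (2 * z)))%:E)%E.
  rewrite -(@leeD2rE _ (lam + lam * (kap / z))%:E)//.
  apply: (@le_trans _ _ (E + (lam%:E + (lam / 8)%:E * \int[leb]_x (I x)%:E))%E).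
    by rewrite leeD2l// EFinD leeD2l// -lI EFinM lee_wpmul2l// lee_fin divr_ge0// ltW.
  apply: (le_trans key); rewrite -!EFinD lee_fin lc.
  by rewrite le_eqVlt; apply/orP; left; apply/eqP; field; rewrite gt_eqF.
apply: (le_trans E1); rewrite lee_fin.
have -> : kap ^+ 2 * alpha / (32 * z ^+ 2) = lam * (kap / (2 * z)).
  by rewrite /lam; field; rewrite gt_eqF.
exact: expR_ge1Dx.
Qed.

End Expectations.

(** * The Chernoff product and the pathwise decomposition of the risk *)

Section Assembly.
Context {R : realType}.
Local Notation leb := (@lebesgue_measure R).
Local Notation phi := (@phi R).
Local Notation gconv := (@gconv R).
Implicit Types (x y a b z alpha lam : R) (theta X : nat -> R).

Lemma apost_mono a b x : 0 <= a -> a <= b -> b <= 1 -> apost a x <= apost b x.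
Proof.
move=> a0 ab b1; have a01 : 0 <= a <= 1 by lra.
have b01 : 0 <= b <= 1 by lra.
have ma := mixture_gt0 x a01; have mb := mixture_gt0 x b01.
rewrite /apost -/(mixture a x) -/(mixture b x) ler_pdivrMr// mulrAC ler_pdivlMr//.
have p0 := phi_gt0 x; have g0 := gconv_gt0 x; rewrite /mixture.
have : 0 <= (b - a) * (gconv x * phi x) by rewrite mulr_ge0 ?mulr_ge0 ?(ltW p0) ?(ltW g0)//; lra.
lra.
Qed.

Lemma sum_if_le n s c theta : 0 <= c -> in_l0 n s theta ->
  \sum_(j < n) (if theta j == 0 then 0 else c) <= s * c.
Proof.
move=> c0 th.
rewrite (eq_bigr (fun j : 'I_n => if theta j != 0 then c else 0)); last first.
  by move=> j _; case: eqP.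
rewrite -big_mkcond/= sumr_const -mulr_natl ler_wpM2r//.
rewrite (le_trans _ th)// ler_nat.
by apply/subset_leq_card/fintype.subsetP => i; rewrite !inE.
Qed.

(** Each zero coordinate contributes exp(- v) and each signal at most exp t, whence the exponent - v
    n + s (v + t). *)
Lemma sum_prod_bound_exp_score n theta (j : 'I_n) s alpha z :
  theta j = 0 -> in_l0 n s theta -> 0 < alpha -> alpha <= 2^-1 -> 1 <= z ->
  (forall y, z <= y -> phi y <= alpha * gconv y) ->
  sum_prod_bound (data_coord theta) n
   (fun X => (1 + X j ^+ 2) * \prod_(i < n) expR (kap * alpha / (16 * z) * score alpha (X i)))
   (4 * Cv * expR (- (kap ^+ 2 * alpha / (32 * z ^+ 2)) * n%:R +
      s * (kap ^+ 2 * alpha / (32 * z ^+ 2) + kap / (16 * z)))).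
Proof.
move=> tj th a0 a1 z1 tail.
set lam := kap * alpha / (16 * z); set v := kap ^+ 2 * alpha / (32 * z ^+ 2).
set t := kap / (16 * z).
have k0 := @kap_gt0 R; have k1 : kap <= 1 :> R by rewrite /kap; have := @cg_le1 R; have := @cg_gt0 R; lra.
have z0 : 0 < z by lra.
have t0 : 0 <= t by apply: divr_ge0; [exact: ltW|rewrite mulr_ge0// ltW].
have lE : lam / alpha = t by rewrite /lam /t; field; rewrite !gt_eqF.
have l0 : 0 <= lam.
  by have -> : lam = t * alpha; [rewrite -lE divfK// gt_eqF|rewrite mulr_ge0// ltW].
have t2 : t <= 2^-1.
  rewrite /t ler_pdivrMr; lra.
have la : lam <= alpha / 2.
  have -> : lam = t * alpha by rewrite -lE divfK// gt_eqF.
  by rewrite mulrC ler_pM2l//; lra.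
have v0 : 0 <= v.
  by apply: divr_ge0; apply: mulr_ge0; rewrite ?sqr_ge0// ltW.
have v2 : v <= 2^-1.
  have k2 : kap ^+ 2 <= 1 :> R by rewrite exprn_ile1// ltW.
  have z2 : 1 <= z ^+ 2 by rewrite exprn_ege1.
  rewrite /v ler_pdivrMr; last by rewrite mulr_gt0//; lra.
  have : kap ^+ 2 * alpha <= 1 * alpha by rewrite ler_pM2r.
  lra.
pose w i := if theta i == 0 then - v else t.
pose f (i : nat) x := (if i == j then 1 + x ^+ 2 else 1) * expR (lam * score alpha x).
(* Coordinate j carries the polynomial weight and has no decay. The factor [expR v], at most 2,
   cancels its nominal exp(- v) and keeps the exponents uniform over zero coordinates. *)
pose m (i : nat) := (if i == j then 2 * Cv * expR v else 1) * expR (w i).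
have Cv0 := @Cv_gt0 R.
have f0 i x : 0 <= f i x.
  by rewrite mulr_ge0 ?expR_ge0//; case: ifP => // _; rewrite addr_ge0 ?sqr_ge0.
have a01 : 0 <= alpha <= 1 by lra.
have mf i : measurable_fun [set: R] (f i).
  apply: measurable_funM.
    by case: (i == j) => //; apply: measurable_funD => //; exact: measurable_funX.
  apply: measurableT_comp => //; apply: measurable_funM => //.
  exact: measurable_score.
have fm i : (data_coord theta i (EFin \o f i) <= (m i)%:E)%E.
  rewrite /f /m /w; case: eqP => [->|_].
    rewrite tj eqxx -mulrA -expRD subrr expR0 mulr1.
    by apply: data_coord_poly_exp => //; lra.
  rewrite !mul1r (_ : EFin \o _ = EFin \o (fun x => expR (lam * score alpha x))); last first.
    by apply/funext => x /=; rewrite mul1r.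
  case: eqP => ti; first exact: data_coord_exp_score_null.
  by rewrite -lE; apply: data_coord_exp_score => //; lra.
have := @sum_prod_bound_prod R (data_coord theta) n f m 1 ler01 f0 mf fm.
apply: sum_prod_bound_le => [X|].
  rewrite mul1r big_split/= ler_wpM2r//.
    by apply: prodr_ge0 => i _; exact: expR_ge0.
  by rewrite (bigD1 j)//= eqxx big1 ?mulr1// => i ij; rewrite ifN.
rewrite mul1r big_split/= -expR_sum.
rewrite (bigD1 j)//= eqxx big1 ?mulr1; last by move=> i ij; rewrite ifN.
apply: ler_pM; rewrite ?expR_ge0//.
- by rewrite !mulr_ge0 ?expR_ge0// ltW.
- have e2 : expR v <= 2 by apply: le_trans (expR_le_quad v2) _; have : v ^+ 2 <= v * 2^-1; [rewrite expr2 ler_wpM2l|lra].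
  have : 2 * Cv * expR v <= 2 * Cv * 2 by rewrite ler_pM2l// mulr_gt0.
  lra.
- rewrite ler_expR (eq_bigr (fun i : 'I_n => - v + (if theta i == 0 then 0 else v + t))).
    rewrite big_split/= sumr_const card_ord -(mulr_natr (- v)) lerD2l.
    by apply: sum_if_le => //; rewrite addr_ge0.
  by move=> i _; rewrite /w; case: eqP => _; ring.
Qed.

Definition Cn : R := 2 + 2 * Cp.

Lemma Cn_gt0 : 0 < Cn. Proof. by rewrite /Cn; have := @Cp_gt0 R; lra. Qed.

(** The weight used is random, but in each of the three cases of the trichotomy its contribution on
    zero coordinates is dominated by a deterministic functional of X. Adding the three dominations
    makes the case distinction disappear before integration. *)
Lemma risk_le A n s ahat theta W as_ aA ap z1 z2 z :
  in_l0 n s theta -> 0 <= W ->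
  (forall X, 0 <= ahat_A A n ahat X <= 1) ->
  (forall X, \sum_(i < n | theta i != 0) (1 - apost (ahat_A A n ahat X) (X i)) * X i ^+ 2 <= W) ->
  (forall X, [\/ ahat_A A n ahat X <= as_, ahat_A A n ahat X <= aA |
     0 <= \sum_(i < n) score ap (X i)]) ->
  0 <= as_ <= 2^-1 -> 0 <= aA <= 2^-1 -> 0 < ap <= 2^-1 ->
  0 <= z1 -> 0 <= z2 -> 1 <= z -> (forall y, z <= y -> phi y <= ap * gconv y) ->
  (risk A n ahat theta <= (s * (Cn * Cv) + 2 * W +
     Cn * (n%:R * (Ca * (as_ * z1 + expR (- (z1 ^+ 2 / 4))))) +
     Cn * (n%:R * (Ca * (aA * z2 + expR (- (z2 ^+ 2 / 4))))) +
     Cn * (n%:R * (4 * Cv * expR (- (kap ^+ 2 * ap / (32 * z ^+ 2)) * n%:R +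
      s * (kap ^+ 2 * ap / (32 * z ^+ 2) + kap / (16 * z))))))%:E)%E.
Proof.
move=> th W0 h01 hsig hnull /andP[as0 as1] /andP[aA0 aA1] /andP[ap0 ap1] z10 z20 zz1 tail.
have Cn0 := Cn_gt0; have Cp0 := @Cp_gt0 R; have Cv0 := @Cv_gt0 R.
have Ca0 : 0 <= Ca :> R.
  by rewrite addr_ge0// mulr_ge0// ltW// Cg_gt0.
have d1 i : (data_coord theta i (fun=> 1) <= 1)%E by exact: data_coord1.
pose lam := kap * ap / (16 * z).
pose E X := \prod_(i < n) expR (lam * score ap (X i)).
pose H1 (j : 'I_n) X := if theta j == 0 then 0 else Cn * (1 + (X j - theta j) ^+ 2).
pose H2 b (j : 'I_n) X := if theta j == 0 then apost b (X j) * (1 + X j ^+ 2) else 0.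
pose H3 (j : 'I_n) X := if theta j == 0 then (1 + X j ^+ 2) * E X else 0.
have sumle (m : R) : 0 <= m -> \sum_(j < n) (if theta j == 0 then m else 0) <= n%:R * m.
  move=> m0; apply: (@le_trans _ _ (\sum_(j < n) m)).
    by apply: ler_sum => j _; case: ifP.
  by rewrite sumr_const card_ord mulr_natl.
have B0 : sum_prod_bound (data_coord theta) n (fun=> 0) 0 by exact: sum_prod_bound_cst.
have B1 : sum_prod_bound (data_coord theta) n (fun X => \sum_(j < n) H1 j X) (s * (Cn * Cv)).
  apply: sum_prod_bound_le (sum_prod_bound_sum (H := H1) (M := fun j : 'I_n => if theta j == 0 then 0 else Cn * Cv) _).
  - by move=> X; exact: lexx.
  - by apply: sum_if_le => //; rewrite mulr_ge0// ltW.
  - move=> j; rewrite /H1; case: eqP => _ //.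
    apply: (@sum_prod_bound1 R (data_coord theta) n j (fun x => Cn * (1 + (x - theta j) ^+ 2))) => //.
    + by move=> x; rewrite mulr_ge0 ?(ltW Cn0)// addr_ge0 ?sqr_ge0.
    + apply: measurable_funM => //; apply: measurable_funD => //.
      by apply: measurable_funX; exact: measurable_funB.
    + exact/data_coord_poly/ltW.
have B2 b z' : 0 <= b -> b <= 2^-1 -> 0 <= z' ->
    sum_prod_bound (data_coord theta) n (fun X => \sum_(j < n) H2 b j X)
      (n%:R * (Ca * (b * z' + expR (- (z' ^+ 2 / 4))))).
  move=> b0 b1 z'0; have b01 : 0 <= b <= 1 by rewrite b0/=; lra.
  apply: sum_prod_bound_le (sum_prod_bound_sum (H := H2 b) (M := fun j : 'I_n => if theta j == 0 then Ca * (b * z' + expR (- (z' ^+ 2 / 4))) else 0) _).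
  - by move=> X; exact: lexx.
  - by apply: sumle; rewrite mulr_ge0// addr_ge0 ?expR_ge0// mulr_ge0.
  - move=> j; rewrite /H2; case: eqP => tj //.
    apply: (@sum_prod_bound1 R (data_coord theta) n j (fun x => apost b x * (1 + x ^+ 2))) => //.
    + by move=> x; apply: mulr_ge0; [exact: apost_ge0|rewrite addr_ge0 ?sqr_ge0].
    + apply: measurable_funM; first exact: measurable_apost.
      by apply: measurable_funD => //; exact: measurable_funX.
    + exact: data_coord_apost.
set v3 := 4 * Cv * expR _.
have B3 : sum_prod_bound (data_coord theta) n (fun X => \sum_(j < n) H3 j X) (n%:R * v3).
  apply: sum_prod_bound_le (sum_prod_bound_sum (H := H3) (M := fun j : 'I_n => if theta j == 0 then v3 else 0) _).
  - by move=> X; exact: lexx.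
  - by apply: sumle; rewrite mulr_ge0 ?expR_ge0// mulr_ge0// ltW.
  - move=> j; rewrite /H3; case: eqP => tj //.
    exact: sum_prod_bound_exp_score.
have BW : sum_prod_bound (data_coord theta) n (fun=> 2 * W) (2 * W).
  by apply: sum_prod_bound_cst => //; rewrite mulr_ge0.
have Cn0' := ltW Cn0.
have BB := sum_prod_boundD (sum_prod_boundD (sum_prod_boundD (sum_prod_boundD B1 BW)
   (sum_prod_boundZ Cn0' (B2 as_ z1 as0 as1 z10)))
   (sum_prod_boundZ Cn0' (B2 aA z2 aA0 aA1 z20))) (sum_prod_boundZ Cn0' B3).
apply: (le_iterint_bound _ _ _ BB).
- by move=> i; exact: data_coord_positive.
- by move=> X; exact: post_risk_ge0.
move=> X; apply: (le_trans (post_risk_le n X theta (h01 X))); rewrite lee_fin.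
set al := ahat_A A n ahat X.
apply: (@le_trans _ _ (\sum_(j < n) (H1 j X + (if theta j == 0 then 0 else
     2 * ((1 - apost al (X j)) * X j ^+ 2)) + Cn * H2 as_ j X + Cn * H2 aA j X + Cn * H3 j X))).
  apply: ler_sum => j _; rewrite /coord_loss /H1 /H2 /H3; case: eqP => tj; last first.
    rewrite !mulr0 !addr0 /Cn; have := sqr_ge0 (X j - theta j).
    have : 0 <= Cp * (X j - theta j) ^+ 2 by rewrite mulr_ge0 ?sqr_ge0// ltW.
    lra.
  rewrite !add0r -!mulrDr.
  have a0 := apost_ge0 (X j) (h01 X); have ac := apostC_ge0 (X j) (h01 X).
  have x0 : 0 <= 1 + X j ^+ 2 by rewrite addr_ge0 ?sqr_ge0.
  apply: (@le_trans _ _ (Cn * (apost al (X j) * (1 + X j ^+ 2)))).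
    rewrite [leRHS]mulrCA ler_wpM2l// /Cn; have := sqr_ge0 (X j).
    have : 0 <= Cp * X j ^+ 2 by rewrite mulr_ge0 ?sqr_ge0// ltW.
    lra.
  rewrite ler_wpM2l// [(1 + _) * E X]mulrC -!mulrDl ler_wpM2r//.
  have as01 : 0 <= as_ <= 1 by rewrite as0/=; lra.
  have aA01 : 0 <= aA <= 1 by rewrite aA0/=; lra.
  have p1 := apost_ge0 (X j) as01; have p2 := apost_ge0 (X j) aA01.
  have E0 : 0 <= E X by apply: prodr_ge0 => i _; exact: expR_ge0.
  case/andP: (h01 X) => al0 al1.
  case: (hnull X) => h.
  - have : apost al (X j) <= apost as_ (X j) by apply: apost_mono => //; lra.
    lra.
  - have : apost al (X j) <= apost aA (X j) by apply: apost_mono => //; lra.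
    lra.
  (* Chernoff's device: a nonnegative total score makes the exponential product at least 1, and it
     multiplies the trivial bound 1 for the posterior weight. *)
  - have : 1 <= E X.
      rewrite /E -expR_sum -expR0 ler_expR -mulr_sumr mulr_ge0//.
      have k0 := @kap_gt0 R; apply: divr_ge0; apply: mulr_ge0 => //; first exact: ltW.
        exact: ltW.
      by apply: le_trans zz1.
    lra.
rewrite !big_split/= -!mulr_sumr !lerD2r lerD2l.
rewrite (eq_bigr (fun j : 'I_n => if theta j != 0 then 2 * ((1 - apost al (X j)) * X j ^+ 2) else 0)); last first.
  by move=> j _; case: eqP.
rewrite -big_mkcond/= -mulr_sumr ler_pM2l//; exact: hsig.
Qed.

End Assembly.

(** * Deterministic properties of the modified estimator *)

Section Estimator.
Context {R : realType}.
Local Notation phi := (@phi R).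
Local Notation gconv := (@gconv R).
Implicit Types (x y a b z l : R) (theta X : nat -> R).

Lemma apost_1 x : apost 1 x = 1 :> R.
Proof.
by rewrite /apost subrr mul0r add0r !mul1r divff// lt0r_neq0// gconv_gt0.
Qed.

(** On the branch [alpha_A] the score inequality still comes from [ahat], which lies below [b0]
    there, while the posterior weight is that of [alpha_A]. *)
Lemma ahat_A_sum_sqr_le A n s ahat theta X b0 M1 M2 :
  is_mle n ahat -> 0 < alpha_n R n -> 0 < alpha_A A n <= 1 ->
  0 < b0 -> b0 <= 1 -> 0 <= M1 -> 1 <= M2 -> ln 2 <= M1 ->
  - ln (alpha_A A n) <= M1 - M2 * ln b0 ->
  (forall a, 0 < a -> a <= 1 -> t_n R n < tthr a -> a < b0) ->
  1 <= s -> s <= n%:R -> in_l0 n s theta ->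
  \sum_(i < n | theta i != 0) (1 - apost (ahat_A A n ahat X) (X i)) * X i ^+ 2 <=
  s * (Kx + 4 + 4 * M1) + 4 * M2 * (s * ln (n%:R / s) + 2 * Cs ^+ 2 * s).
Proof.
move=> mle an0 /andP[aA0 aA1] b00 b01 M10 M21 M12 aAb ub s1 sn th.
have [/andP[h1 h2] _] := mle X.
have ah0 : 0 < ahat X by exact: lt_le_trans h1.
rewrite /ahat_A; case: ifPn => [_|]; last first.
  rewrite -ltNge => /(ub _ ah0 h2) hb.
  apply: (sum_weighted_sqr_le b00 b01) => //.
  exact: mle_score_le0 mle (ltW ah0) hb b01.
(* At [ahat X = 1] there is no room for a larger b, but the posterior then gives no mass to 0. *)
move: h2; rewrite le_eqVlt => /orP[/eqP ->|h2].
  under eq_bigr do rewrite apost_1 subrr mul0r.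
  rewrite big1_eq.
  have K0 : 0 <= Kx :> R by rewrite normr_ge0.
  have L0 : 0 <= ln (n%:R / s) by rewrite ln_ge0// ler_pdivlMr//; lra.
  have sL : 0 <= s * ln (n%:R / s) by rewrite mulr_ge0//; lra.
  have Q0 : 0 <= 2 * Cs ^+ 2 * s by have := sqr_ge0 (@Cs R) => ?; apply: mulr_ge0; lra.
  by apply: addr_ge0; apply: mulr_ge0; lra.
have [b2|b2] := leP (2 * ahat X) 1.
  (* With b = 2 ahat <= 1, - ln ahat = ln 2 - ln b, which [M1 >= ln 2] and [M2 >= 1] cover. *)
  apply: (@sum_weighted_sqr_le _ n s (2 * ahat X)) => //; try lra.
    rewrite lnM ?posrE//; have : 0 <= (M2 - 1) * - ln (2 * ahat X).
      by rewrite mulr_ge0//; [lra|have := ln_le0 b2; lra].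
    by rewrite lnM ?posrE//; lra.
  by apply: (mle_score_le0 mle); lra.
apply: (@sum_weighted_sqr_le _ n s 1) => //; try lra.
  rewrite ln1 mulr0 subr0; apply: le_trans M12.
  rewrite -lnV ?posrE// ler_ln ?posrE ?invr_gt0//.
  by rewrite -[2]invrK lef_pV2 ?posrE//; lra.
by apply: (mle_score_le0 mle); lra.
Qed.

(** If [ahat] is retained, its threshold is at most [t_n], so it exceeds [a2]; if it also exceeds
    [as_], it exceeds their maximum, where the score sum is then nonnegative. *)
Lemma ahat_A_trichotomy A n ahat X as_ a2 :
  is_mle n ahat -> 0 < alpha_n R n -> 0 <= a2 -> alpha_n R n <= a2 ->
  (forall a, 0 < a -> a <= 1 -> tthr a <= t_n R n -> a2 < a) ->
  [\/ ahat_A A n ahat X <= as_, ahat_A A n ahat X <= alpha_A A n |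
     0 <= \sum_(i < n) score (Num.max as_ a2) (X i)].
Proof.
move=> mle an0 a20 ana lb.
have [/andP[h1 h2] _] := mle X.
have ah0 : 0 < ahat X by exact: lt_le_trans h1.
rewrite /ahat_A; case: ifPn => [/(lb _ ah0 h2) h|_]; last by apply: Or32.
have [hs|hs] := leP (ahat X) as_; first exact: Or31.
apply: Or33; apply: (mle_score_ge0 mle).
- by rewrite le_max a20 orbT.
- by rewrite le_max ana orbT.
- by rewrite gt_max hs h.
Qed.

(** Chosen so that y >= Kz sqrt l gives y^2 / 4 >= l + (4 / cg) l: the first term matches exp(- l)
    <= a, the second absorbs the factor 4 / cg. *)
Definition Kz : R := Num.sqrt (4 * (1 + 4 / cg)).

Lemma Kz_sqr : Kz ^+ 2 = 4 * (1 + 4 / cg).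
Proof.
have c0 : 0 < 4 / cg :> R by rewrite divr_gt0 ?cg_gt0.
by rewrite sqr_sqrtr//; lra.
Qed.

Lemma Kz_ge1 : 1 <= Kz.
Proof.
have c0 : 0 < 4 / cg :> R by rewrite divr_gt0 ?cg_gt0.
have k0 : 0 <= Kz by rewrite sqrtr_ge0.
have := Kz_sqr; nra.
Qed.

Lemma phi_le_tail a l y : 1 <= l -> expR (- l) <= a ->
  Kz * Num.sqrt l <= y -> phi y <= a * gconv y.
Proof.
move=> l1 al zy; have c0 := @cg_gt0 R; have K1 := Kz_ge1.
have dy : 0 < 1 + y ^+ 2 by rewrite ltr_pwDl ?sqr_ge0.
have y2 : 4 * (1 + 4 / cg) * l <= y ^+ 2.
  rewrite -Kz_sqr -{1}(@sqr_sqrtr _ l); last lra.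
  have z0 : 0 <= Kz * Num.sqrt l by apply: mulr_ge0; exact: sqrtr_ge0.
  by rewrite -exprMn lerXn2r// nnegrE ?(le_trans z0).
apply: (@le_trans _ _ (expR (- l) * (cg / (1 + y ^+ 2)))); last first.
  apply: ler_pM; rewrite ?expR_ge0 ?gconv_ge//.
  by rewrite divr_ge0// ltW.
rewrite mulrA ler_pdivlMr//.
apply: (@le_trans _ _ (expR (- (y ^+ 2) / 2) * (4 * expR (y ^+ 2 / 4)))).
  apply: ler_pM; rewrite ?phi_ge0 ?phi_le_expR ?(ltW dy)//.
  by have := expR_ge1Dx (y ^+ 2 / 4); have := sqr_ge0 y; lra.
rewrite mulrCA -expRD.
have c40 : 0 < 4 / cg :> R by exact: divr_gt0.
apply: (@le_trans _ _ (4 * expR (- l - 4 / cg))).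
  rewrite ler_pM2l// ler_expR.
  have : 4 / cg * 1 <= 4 / cg * l by rewrite ler_pM2l.
  lra.
rewrite expRD mulrCA ler_pM2l ?expR_gt0// expRN ler_pdivrMr ?expR_gt0//.
have : cg * (4 / cg) <= cg * expR (4 / cg) :> R.
  by rewrite ler_pM2l//; have := expR_ge1Dx (4 / cg : R); lra.
by rewrite mulrC divfK// lt0r_neq0.
Qed.

Lemma expR_ge_sqr x : 0 <= x -> x ^+ 2 / 2 <= expR x.
Proof. by move=> x0; have := expR_ge1Dxn 1 x0; rewrite (_ : 2`! = 2)//; lra. Qed.

Lemma expR_ge_cube x : 0 <= x -> x ^+ 3 / 6 <= expR x.
Proof. by move=> x0; have := expR_ge1Dxn 2 x0; rewrite (_ : 3`! = 6)//; lra. Qed.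

Lemma ln_le_fifth l : 50 <= l -> 5 * ln l <= l.
Proof.
move=> l50; have l0 : 0 < l by lra.
suff : l <= expR (l / 5).
  by rewrite -{1}(@lnK _ l) ?posrE// ler_expR; lra.
apply: le_trans (_ : (l / 5) ^+ 2 / 2 <= _); last by apply: expR_ge_sqr; lra.
have : 50 * l <= l * l by rewrite ler_pM2r.
lra.
Qed.

End Estimator.

(** * Numerical bounds for large n *)

Section Constants.
Context {R : realType}.
Implicit Types (x y a A z l s : R).

Lemma tinv_bounds y : 1 <= y -> [/\ 0 < tinv y, tinv y < 1,
  cT * expR (- (y ^+ 2 / 2)) <= tinv y &
  tinv y <= expR 1 * Ct * ((1 + y ^+ 2) * expR (- (y ^+ 2 / 2)))].
Proof.
move=> y1; have y0 : 0 < y by lra.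
have [/andP[t0 t1] ty] := tinvP y0; split => //.
- by apply: tthr_le_lb (ltW t1) _ _ => //; [lra|rewrite ty].
- exact: tthr_eq_ub (ltW t1) y1 ty.
Qed.

Lemma sqrt_ge1 x : 1 <= x -> 1 <= Num.sqrt x.
Proof. by move=> x1; rewrite -[leLHS]sqrtr1 ler_sqrt//; lra. Qed.

Lemma sqrt_le_id x : 1 <= x -> Num.sqrt x <= x.
Proof.
move=> x1; rewrite -{2}(@sqr_sqrtr _ x); last lra.
by rewrite expr2 ler_peMl ?sqrtr_ge0// sqrt_ge1.
Qed.

Lemma expR1_le4 : expR 1 <= 4 :> R.
Proof.
have := @expR_le_quad R 2^-1 (lexx _); have := expR_ge0 (2^-1 : R).
have -> : expR 1 = expR 2^-1 * expR 2^-1 :> R by rewrite -expRD; congr expR; field.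
move: (expR _) => e e0 e1; have : e * e <= 2 * 2 by apply: ler_pM; lra.
lra.
Qed.

Lemma t_n_sqr n l : ln n%:R = l -> 50 <= l ->
  [/\ t_n R n ^+ 2 = 2 * l - 5 * ln l & l <= t_n R n ^+ 2].
Proof.
move=> <- l50; have := ln_le_fifth l50 => h.
have E : t_n R n ^+ 2 = 2 * ln n%:R - 5 * ln (ln n%:R) by rewrite sqr_sqrtr//; lra.
by split=> //; rewrite E; lra.
Qed.

(* If P n >= C1 s sqrt L, the drift of the zero coordinates dominates the signals in
   the Chernoff exponent; if P n >= C2 l^2, the exponent is moreover below - l. *)
Definition C1 : R := 1 + 8 * Kz / kap.
Definition C2 : R := 64 * Kz ^+ 2 / kap ^+ 2.
Definition CA A : R := expR 1 * Ct * (3 + 2 * A) * 4 / A ^+ 2.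
(** All summands are nonnegative, so a logarithm above the sum meets every size requirement at
    once. *)
Definition large_log A : R :=
  50 + 12 * C2 + (C2 / cT) ^+ 2 + 3 * (expR 1 * Ct) / C2 + 32 * Ct + 2 * CA A.

Lemma C1_ge1 : 1 <= C1.
Proof.
rewrite /C1 lerDl; apply: divr_ge0; last exact/ltW/kap_gt0.
by apply: mulr_ge0 => //; apply: le_trans Kz_ge1.
Qed.

Lemma C2_gt0 : 0 < C2.
Proof.
have k := @kap_gt0 R; have K : 0 < Kz :> R := lt_le_trans ltr01 Kz_ge1.
by apply: divr_gt0; [apply: mulr_gt0 => //|]; exact: exprn_gt0.
Qed.

Lemma CA_gt0 A : 0 < A -> 0 < CA A.
Proof.
move=> A0; apply: divr_gt0; last exact: exprn_gt0.
apply: mulr_gt0 => //; apply: mulr_gt0; last lra.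
by apply: mulr_gt0 (@Ct_gt0 R); exact: expR_gt0.
Qed.

Lemma large_logP A l : 0 < A -> large_log A <= l ->
  [/\ 50 <= l, 12 * C2 <= l & (C2 / cT) ^+ 2 < l] /\
  [/\ 3 * (expR 1 * Ct) / C2 <= l, 32 * Ct <= l & 2 * CA A <= l].
Proof.
move=> A0; rewrite /large_log.
have := CA_gt0 A0; have := C2_gt0; have := @Ct_gt0 R; have := sqr_ge0 (C2 / cT : R).
have : 0 <= 3 * (expR 1 * Ct) / C2 :> R.
  apply: divr_ge0; last exact/ltW/C2_gt0.
  by apply: mulr_ge0 => //; apply: mulr_ge0; [exact: expR_ge0|exact/ltW/Ct_gt0].
move: (3 * (expR 1 * Ct) / C2) ((C2 / cT) ^+ 2) (CA A) => p q r.
by move: C2 Ct => c d *; split; split; lra.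
Qed.

Lemma C2_sqr_le l : 0 < l -> 12 * C2 <= l -> C2 * l ^+ 2 / expR l <= 2^-1.
Proof.
move=> l0 lC; rewrite ler_pdivrMr ?expR_gt0//.
apply: le_trans (_ : 2^-1 * (l ^+ 3 / 6) <= _); last by rewrite ler_pM2l// expR_ge_cube// ltW.
have : (12 * C2) * l ^+ 2 <= l * l ^+ 2 by rewrite ler_pM2r// exprn_gt0.
by rewrite -exprS; lra.
Qed.

(** The 5 log log n in t_n^2 makes exp(- t_n^2 / 2) equal to l^(5/2) / n, which beats l^2 / n by a
    factor sqrt l, named [h] below. *)
Lemma C2_sqr_lt_t_n n l : ln n%:R = l -> 50 <= l -> (C2 / cT) ^+ 2 < l ->
  C2 * l ^+ 2 / expR l < cT * expR (- (t_n R n ^+ 2 / 2)).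
Proof.
move=> nl l50 lC; have [-> _] := t_n_sqr nl l50; have l0 : 0 < l by lra.
have c0 := @cT_gt0 R.
have -> : - ((2 * l - 5 * ln l) / 2) = - l + (ln l + ln l + ln l / 2) by field.
rewrite 2!expRD [expR (_ + _)]expRD lnK ?posrE// expRN.
set h := expR (ln l / 2).
have hl : h ^+ 2 = l by rewrite -expRM_natl mulrC divfK ?lnK ?posrE.
have h1 : C2 / cT < h.
  rewrite -(@ltr_pXn2r _ 2) ?nnegrE ?expR_ge0 ?hl//.
  by apply: divr_ge0; apply: ltW => //; exact: C2_gt0.
rewrite ltr_pdivrMr// in h1.
have -> : cT * ((expR l)^-1 * (l * l * h)) = h * cT * l ^+ 2 / expR l by ring.
by rewrite ltr_pM2r ?invr_gt0 ?expR_gt0// ltr_pM2r// exprn_gt0.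
Qed.

(** [alpha_n] is only O(l / n), so the level C2 l^2 / n lies in the range where [ahat] maximises. *)
Lemma alpha_n_bounds n l : n%:R = expR l -> 1 <= l ->
  3 * (expR 1 * Ct) / C2 <= l ->
  0 < alpha_n R n /\ alpha_n R n <= C2 * l ^+ 2 / expR l.
Proof.
move=> nl l1 lC; have lnn : ln n%:R = l :> R by rewrite nl expRK.
have y1 : 1 <= Num.sqrt (2 * l) by apply: sqrt_ge1; lra.
have y2 : Num.sqrt (2 * l) ^+ 2 = 2 * l by rewrite sqr_sqrtr//; lra.
have := tinv_bounds y1; rewrite y2 /alpha_n lnn => -[a0 _ _ a1]; split=> //.
apply: (le_trans a1); have -> : 2 * l / 2 = l by field.
rewrite expRN mulrA ler_pM2r ?invr_gt0 ?expR_gt0//.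
have c0 : 0 < expR 1 * Ct :> R by rewrite mulr_gt0 ?expR_gt0 ?Ct_gt0.
rewrite ler_pdivrMr ?C2_gt0// in lC.
apply: (@le_trans _ _ (3 * (expR 1 * Ct) * l)).
  move: (expR 1 * Ct) c0 => q q0; have : q * 1 <= q * l by rewrite ler_pM2l.
  lra.
have : 3 * (expR 1 * Ct) * l <= l * C2 * l by rewrite ler_pM2r//; lra.
by rewrite expr2; lra.
Qed.

(** n [alpha_A] is of order l exp(- A l); positivity of A enters through l^2 exp(- A l) <= 2 /
    A^2. *)
Lemma alpha_A_bounds A n l : 0 < A -> n%:R = expR l -> 50 <= l -> 2 * CA A <= l ->
  [/\ 0 < alpha_A A n, alpha_A A n <= 2^-1,
      - ln (alpha_A A n) <= - ln cT + (1 + A) * l &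
      n%:R * (alpha_A A n * (2 * Num.sqrt l)) <= CA A].
Proof.
move=> A0 nl l50 lC; have lnn : ln n%:R = l :> R by rewrite nl expRK.
have l0 : 0 < l by lra.
have Al0 : 0 < A * l by rewrite mulr_gt0.
have e2 : 2 * (1 + A) * l = 2 * ((1 + A) * l) by ring.
have y1 : 1 <= Num.sqrt (2 * (1 + A) * l) by apply: sqrt_ge1; lra.
have y2 : Num.sqrt (2 * (1 + A) * l) ^+ 2 = 2 * ((1 + A) * l) by rewrite sqr_sqrtr; lra.
have := tinv_bounds y1; rewrite y2 /alpha_A /t_A lnn.
have -> : 2 * ((1 + A) * l) / 2 = (1 + A) * l by field.
move: (tinv _) => a [a0 a1 alb aub].
have c0 := @cT_gt0 R; have E0 := expR_gt0 l.
have C0 : 0 < expR 1 * Ct :> R by rewrite mulr_gt0 ?expR_gt0 ?Ct_gt0.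
have s0 : 0 <= Num.sqrt l by rewrite sqrtr_ge0.
have s1 : 1 <= Num.sqrt l by apply: sqrt_ge1; lra.
have sl : Num.sqrt l <= l by apply: sqrt_le_id; lra.
have key : n%:R * (a * (2 * Num.sqrt l)) <= CA A.
  have h1 : expR l * a <= expR 1 * Ct * ((3 + 2 * A) * l) * expR (- (A * l)).
    apply: (@le_trans _ _ (expR l * (expR 1 * Ct * ((1 + 2 * ((1 + A) * l)) * expR (- ((1 + A) * l)))))).
      by rewrite ler_pM2l.
    have -> : - ((1 + A) * l) = - l + - (A * l) by ring.
    rewrite expRD [expR (- l)]expRN.
    rewrite [leLHS](_ : _ = expR 1 * Ct * (1 + 2 * ((1 + A) * l)) * expR (- (A * l))); last first.
      by field; rewrite gt_eqF.
    by rewrite ler_pM2r ?expR_gt0// ler_pM2l//; lra.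
  have h2 : l ^+ 2 * expR (- (A * l)) <= 2 / A ^+ 2.
    rewrite expRN ler_pdivrMr ?expR_gt0// mulrAC ler_pdivlMr ?exprn_gt0//.
    by have := expR_ge_sqr (ltW Al0); rewrite exprMn; lra.
  rewrite nl mulrA.
  apply: (@le_trans _ _ (expR 1 * Ct * ((3 + 2 * A) * l) * expR (- (A * l)) * (2 * l))).
    apply: ler_pM => //; rewrite ?mulr_ge0// ?(ltW E0) ?(ltW a0)//.
    by rewrite ler_pM2l.
  rewrite [leLHS](_ : _ = 2 * (expR 1 * Ct * (3 + 2 * A)) * (l ^+ 2 * expR (- (A * l)))); last by ring.
  rewrite [CA A](_ : _ = 2 * (expR 1 * Ct * (3 + 2 * A)) * (2 / A ^+ 2)); last by rewrite /CA; ring.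
  by apply: ler_wpM2l h2; apply: mulr_ge0 => //; apply: mulr_ge0; [exact: ltW|lra].
split => //.
- have lE : l <= expR l by have := expR_ge1Dx l; lra.
  have : expR l * a * 1 <= expR l * a * (2 * Num.sqrt l).
    by rewrite ler_wpM2l ?mulr_ge0 ?(ltW E0) ?(ltW a0)//; lra.
  rewrite nl mulrA in key; move=> h.
  rewrite -(ler_pM2l E0); lra.
- have : ln (cT * expR (- ((1 + A) * l))) <= ln a by rewrite ler_ln ?posrE// mulr_gt0 ?expR_gt0.
  by rewrite lnM ?posrE ?expR_gt0// expRK; lra.
Qed.

(** Of the total decay v n, one quarter pays for s v, as s <= n / 4, and one quarter for s t, by the
    first lower bound on P n. The remaining half is at least l by the second. *)
Lemma chernoff_exponent n s l L P z : 0 < n%:R :> R -> 0 <= s -> s <= n%:R / 4 -> 0 < L -> L <= l ->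
  z = Kz * Num.sqrt L -> 8 * Kz / kap * (s * Num.sqrt L) <= P * n%:R -> 
  C2 * l ^+ 2 <= P * n%:R ->
  - (kap ^+ 2 * P / (32 * z ^+ 2)) * n%:R +
    s * (kap ^+ 2 * P / (32 * z ^+ 2) + kap / (16 * z)) <= - l.
Proof.
move=> n0 s0 sn L0 Ll zE P1 P2.
have k0 := @kap_gt0 R; have K0 : 0 < Kz :> R := lt_le_trans ltr01 Kz_ge1.
have l0 : 0 < l by lra.
have z0 : 0 < z by rewrite zE mulr_gt0// sqrtr_gt0.
have z2 : z ^+ 2 = Kz ^+ 2 * L by rewrite zE exprMn (sqr_sqrtr (ltW L0)).
have P0 : 0 <= P.
  have : 0 <= P * n%:R by apply: le_trans P2; apply: mulr_ge0 (sqr_ge0 _); exact/ltW/C2_gt0.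
  by rewrite pmulr_lge0.
set v := kap ^+ 2 * P / (32 * z ^+ 2); set t := kap / (16 * z).
have v0 : 0 <= v by apply: divr_ge0; apply: mulr_ge0; rewrite ?sqr_ge0.
have h1 : s * t <= v * n%:R / 4.
  have -> : v * n%:R / 4 = kap ^+ 2 / (128 * z ^+ 2) * (P * n%:R).
    by rewrite /v; field; rewrite gt_eqF.
  have -> : s * t = kap ^+ 2 / (128 * z ^+ 2) * (8 * Kz / kap * (s * Num.sqrt L)).
    have -> : 8 * Kz / kap * (s * Num.sqrt L) = 8 / kap * s * z by rewrite zE; ring.
    by rewrite /t; field; rewrite !gt_eqF.
  by rewrite ler_wpM2l// divr_ge0 ?sqr_ge0// mulr_ge0// sqr_ge0.
have h2 : l <= v * n%:R / 2.
  have -> : v * n%:R / 2 = kap ^+ 2 / (64 * z ^+ 2) * (P * n%:R).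
    by rewrite /v; field; rewrite gt_eqF.
  apply: (@le_trans _ _ (kap ^+ 2 / (64 * z ^+ 2) * (C2 * l ^+ 2))); last first.
    by rewrite ler_wpM2l// divr_ge0 ?sqr_ge0// mulr_ge0// sqr_ge0.
  have -> : kap ^+ 2 / (64 * z ^+ 2) * (C2 * l ^+ 2) = l ^+ 2 / L.
    by rewrite z2 /C2; field; rewrite !gt_eqF.
  by rewrite ler_pdivlMr// expr2 ler_pM2l.
have h3 : s * v <= n%:R / 4 * v by rewrite ler_wpM2r.
lra.
Qed.

End Constants.

(** * Summation of the risk contributions *)

Section FinalConstants.
Context {R : realType}.
Implicit Types (A M s L l W : R).

Definition CW M1 M2 : R := Kx + 4 + 4 * M1 + 4 * M2 * (1 + 2 * Cs ^+ 2).

Definition Crisk A M1 M2 : R := Cn * Cv + 2 * CW M1 M2 + Cn * (Ca * (2 * C1 + 1)) +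
  Cn * (Ca * (CA A + 1)) + Cn * (4 * Cv).

Lemma Ca_gt0 : 0 < Ca :> R.
Proof.
apply: addr_gt0; apply: mulr_gt0 => //; first exact: Cg_gt0.
by rewrite sqrtr_gt0 mulr_gt0// pi_gt0.
Qed.

Lemma CW_ge0 M1 M2 : 0 <= M1 -> 1 <= M2 -> 0 <= CW M1 M2.
Proof.
move=> M10 M21; have Kx0 : 0 <= Kx :> R by exact: normr_ge0.
have Cs2 : 0 <= Cs ^+ 2 :> R := sqr_ge0 _.
have : 0 <= M2 * (1 + 2 * Cs ^+ 2) by apply: mulr_ge0; lra.
rewrite /CW; lra.
Qed.

Lemma Crisk_gt0 A M1 M2 : 0 < A -> 0 <= M1 -> 1 <= M2 -> 0 < Crisk A M1 M2.
Proof.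
move=> A0 M10 M21; have := CW_ge0 M10 M21; rewrite /Crisk.
have p1 : 0 < Cn * Cv :> R := mulr_gt0 Cn_gt0 Cv_gt0.
have p2 : 0 < Cn * (Ca * (2 * C1 + 1)) :> R.
  apply: mulr_gt0 Cn_gt0 _; apply: mulr_gt0 Ca_gt0 _.
  by have := @C1_ge1 R; lra.
have p3 : 0 < Cn * (Ca * (CA A + 1)).
  apply: mulr_gt0 Cn_gt0 _; apply: mulr_gt0 Ca_gt0 _.
  by have := CA_gt0 A0; lra.
have p4 : 0 < Cn * (4 * Cv) :> R.
  by apply: mulr_gt0 Cn_gt0 _; apply: mulr_gt0 Cv_gt0.
move: (CW _ _) => w w0; move: p1 p2 p3 p4; move: (Cn * Cv) (Cn * (Ca * (2 * C1 + 1))).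
by move: (Cn * (Ca * _)) (Cn * (4 * Cv)) => *; lra.
Qed.

Lemma signal_bound_le M1 M2 s L : 0 <= M1 -> 1 <= M2 -> 0 <= s -> 1 <= L ->
  0 <= s * (Kx + 4 + 4 * M1) + 4 * M2 * (s * L + 2 * Cs ^+ 2 * s) <= CW M1 M2 * (s * L).
Proof.
move=> M10 M21 s0 L1; rewrite /CW; have Kx0 : 0 <= Kx :> R by exact: normr_ge0.
have Cs2 : 0 <= Cs ^+ 2 :> R := sqr_ge0 _.
have sL : s <= s * L by rewrite ler_peMr.
move: Kx (Cs ^+ 2) Kx0 Cs2 => K c K0 c0.
have h1 : (K + 4 + 4 * M1) * s <= (K + 4 + 4 * M1) * (s * L) by apply: ler_wpM2l => //; lra.
have h2 : (M2 * (2 * c)) * s <= (M2 * (2 * c)) * (s * L).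
  by apply: ler_wpM2l => //; apply: mulr_ge0; lra.
have h3 : 0 <= (K + 4 + 4 * M1) * s by apply: mulr_ge0 => //; lra.
have h4 : 0 <= (M2 * (2 * c)) * s by apply: mulr_ge0 => //; apply: mulr_ge0; lra.
have h5 : 0 <= M2 * (s * L) by apply: mulr_ge0; lra.
by apply/andP; split; lra.
Qed.

(** Each of the five terms of [risk_le] is O(s L): the cut-off 2 sqrt L leaves a tail N exp(- L) =
    s, and 2 sqrt l leaves N exp(- l) = 1 <= s. *)
Lemma total_risk_le A M1 M2 (N as_ aA s L l W e qL ql : R) :
  0 < N -> 1 <= s -> 1 <= L -> N * expR (- L) = s -> N * expR (- l) = 1 -> 0 < A ->
  W <= CW M1 M2 * (s * L) -> N * as_ = C1 * s * qL -> qL ^+ 2 = L ->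
  N * (aA * (2 * ql)) <= CA A -> e <= - l ->
  s * (Cn * Cv) + 2 * W + Cn * (N * (Ca * (as_ * (2 * qL) + expR (- L)))) +
     Cn * (N * (Ca * (aA * (2 * ql) + expR (- l)))) +
     Cn * (N * (4 * Cv * expR e)) <= Crisk A M1 M2 * (s * L).
Proof.
move=> N0 s1 L1 NL Nl A0 WC asN qL2 aAN el.
have CA0 := CA_gt0 A0.
have sL : s <= s * L by rewrite ler_peMr//; lra.
have T3 : N * (as_ * (2 * qL) + expR (- L)) <= (2 * C1 + 1) * (s * L).
  rewrite mulrDr NL mulrA asN.
  have -> : C1 * s * qL * (2 * qL) = 2 * C1 * (s * L) by rewrite -[in RHS]qL2; ring.
  by move: (s * L) C1 sL => p c; lra.
have T4 : N * (aA * (2 * ql) + expR (- l)) <= (CA A + 1) * (s * L).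
  rewrite mulrDr Nl; apply: le_trans (_ : (CA A + 1) * 1 <= _).
    by rewrite mulr1 lerD2r.
  by rewrite ler_wpM2l; lra.
have T5 : N * expR e <= s * L.
  apply: (@le_trans _ _ (N * expR (- l))); first by rewrite ler_pM2l// ler_expR.
  by rewrite Nl; lra.
have Cn0 := @Cn_gt0 R; have Cv0 := @Cv_gt0 R; have Ca0 := Ca_gt0.
have q1 : s * (Cn * Cv) <= Cn * Cv * (s * L) by rewrite mulrC ler_pM2l// mulr_gt0.
have q2 : Cn * (N * (Ca * (as_ * (2 * qL) + expR (- L)))) <=
    Cn * (Ca * ((2 * C1 + 1) * (s * L))) by rewrite ler_pM2l// mulrCA ler_pM2l.
have q3 : Cn * (N * (Ca * (aA * (2 * ql) + expR (- l)))) <=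
    Cn * (Ca * ((CA A + 1) * (s * L))) by rewrite ler_pM2l// mulrCA ler_pM2l.
have q4 : Cn * (N * (4 * Cv * expR e)) <= Cn * (4 * Cv * (s * L)).
  by rewrite ler_pM2l// mulrCA ler_pM2l// mulr_gt0.
apply: (le_trans (lerD (lerD (lerD (lerD q1 (_ : 2 * W <= 2 * (CW M1 M2 * (s * L)))) q2) q3) q4)).
  by rewrite ler_pM2l.
rewrite /Crisk; move: (Cn : R) (Cv : R) (Ca : R) (C1 : R) (CA A) (CW M1 M2) => *.
by rewrite le_eqVlt; apply/orP; left; apply/eqP; ring.
Qed.

End FinalConstants.

(** * Choice of the constants and verification of the hypotheses *)

Theorem theorem5 (R : realType) (A : R) : 0 < A ->
  exists (C c0 : R) (N0 : nat), 0 < C /\ 0 < c0 /\ (0 < N0)%N /\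
    forall (n : nat) (s : R) (ahat : (nat -> R) -> R),
      (N0 <= n)%N -> 1 <= s -> s <= c0 * n%:R ->
      is_mle n ahat ->
      forall theta0 : nat -> R, in_l0 n s theta0 ->
        (risk A n ahat theta0 <= (C * r_n n s)%:E)%E.
Proof.
move=> A0.
have cT0 := @cT_gt0 R; have Ct0 := @Ct_gt0 R.
have C11 := @C1_ge1 R; have C20 := @C2_gt0 R; have K1 := @Kz_ge1 R.
(* These match - ln alpha_A <= - ln cT + (1 + A) l against - ln b0 = l / 8. *)
pose M1 : R := - ln cT; pose M2 := 8 * (1 + A).
have M12 : ln 2 <= M1.
  have h2 : 2 <= cT^-1 :> R.
    by rewrite -[leRHS]mul1r ler_pdivlMr//; have := @cT_le R; lra.
  by rewrite /M1 -lnV ?posrE// ler_ln ?posrE//; lra.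
have M10 : 0 <= M1 by apply: le_trans M12; rewrite ln_ge0//; lra.
have M21 : 1 <= M2 by rewrite /M2; lra.
have C0 := Crisk_gt0 A0 M10 M21.
have C12 : 0 < 4 * C1 ^+ 2 :> R by rewrite mulr_gt0// exprn_gt0//; lra.
(* The half compensates the 2 in [r_n]; c0 forces n / s >= 4 C1^2, hence [as_ <= 1/2] and s <= n /
   4; N0 forces ln n >= [large_log A]. *)
exists (Crisk A M1 M2 / 2), (4 * C1 ^+ 2)^-1, (Num.truncn (expR (large_log A))).+1.
split; first by rewrite divr_gt0.
split; first by rewrite invr_gt0.
split=> // n s ahat Nn s1 sn mle theta th.
set l : R := ln n%:R; set L := ln (n%:R / s).
have nM : expR (large_log A) < n%:R.
  by apply: lt_le_trans (truncnS_gt _) _; rewrite ler_nat.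
have n0 : 0 < n%:R :> R := lt_trans (expR_gt0 _) nM.
have nl : n%:R = expR l by rewrite lnK ?posrE.
have lM : large_log A <= l by move: nM; rewrite nl ltr_expR => /ltW.
have [[l50 lC2 lCT] [l3 l32 lCA]] := large_logP A0 lM.
have l0 : 0 < l by lra.
have lCt : 4 * Ct < expR (l / 8) by have := expR_ge1Dx (l / 8); lra.
have half1 : 2^-1 <= 1 :> R by lra.
have s0 : 0 < s by lra.
have y1 : 4 * C1 ^+ 2 <= n%:R / s by rewrite ler_pdivlMr// -ler_pdivlMl.
have C14 : 1 <= C1 ^+ 2 :> R by rewrite exprn_ege1.
have y0 : 0 < n%:R / s by rewrite divr_gt0.
have sn4 : s <= n%:R / 4.
  have : 4 <= n%:R / s by lra.
  by rewrite ler_pdivlMr//; lra.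
have sn' : s <= n%:R by lra.
have e4 := @expR1_le4 R.
have eL : expR L = n%:R / s by rewrite lnK ?posrE.
have L1 : 1 <= L by rewrite -ler_expR eL; lra.
have L0 : 0 < L := lt_le_trans ltr01 L1.
have Ll : L <= l by rewrite ler_ln ?posrE// ler_pdivrMr// ler_peMr// ltW.
have sL0 : s <= s * L by rewrite ler_peMr// ltW.
have enL : n%:R * expR (- L) = s by rewrite expRN eL; field; rewrite !gt_eqF.
have enl : n%:R * expR (- l) = 1 by rewrite nl -expRD subrr expR0.
have sqL : Num.sqrt L ^+ 2 = L by rewrite sqr_sqrtr// ltW.
have sql : Num.sqrt l ^+ 2 = l by rewrite sqr_sqrtr// ltW.
have qL0 := sqrtr_ge0 L; have ql0 := sqrtr_ge0 l.
have qL1 : 1 <= Num.sqrt L by exact: sqrt_ge1.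
pose as_ := C1 * s * Num.sqrt L / n%:R.
have asn : n%:R * as_ = C1 * s * Num.sqrt L by rewrite /as_; field; rewrite gt_eqF.
have as0 : 0 <= as_ by rewrite /as_ divr_ge0 ?(ltW n0)// mulr_ge0// mulr_ge0 ?(ltW s0)// (le_trans ler01).
have as2 : as_ <= 2^-1.
  rewrite -(@ler_pXn2r _ 2) ?nnegrE//.
  (* With n / s = exp L, the square is C1^2 (L exp(- L)) (s / n), where L exp(- L) <= 1. *)
  have -> : as_ ^+ 2 = C1 ^+ 2 * (L * (n%:R / s)^-1) * (n%:R / s)^-1.
    by rewrite /as_ -{2}sqL; field; rewrite !gt_eqF.
  have h1 : L * (n%:R / s)^-1 <= 1.
    by rewrite ler_pdivrMr// mul1r -eL; have := expR_ge1Dx L; lra.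
  rewrite ler_pdivrMr//.
  have : C1 ^+ 2 * (L * (n%:R / s)^-1) <= C1 ^+ 2 * 1 by rewrite ler_pM2l//; lra.
  lra.
pose a2 := C2 * l ^+ 2 / expR l.
have a2n : n%:R * a2 = C2 * l ^+ 2 by rewrite /a2 nl; field; rewrite gt_eqF ?expR_gt0.
have a20 : 0 <= a2 by rewrite /a2 divr_ge0 ?expR_ge0// mulr_ge0 ?sqr_ge0// ltW.
have a22 : a2 <= 2^-1 by exact: C2_sqr_le.
have [an0 ana] : 0 < alpha_n R n /\ alpha_n R n <= a2.
  by apply: alpha_n_bounds => //; lra.
have [aA0 aA2 aAl aAn] := alpha_A_bounds A0 nl l50 lCA.
have [tn2 tnl] := t_n_sqr (erefl l) l50.
have tn0 : 0 <= t_n R n by exact: sqrtr_ge0.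
have lb a : 0 < a -> a <= 1 -> tthr a <= t_n R n -> a2 < a.
  move=> a0 a1 /(tthr_le_lb a0 a1 tn0); apply: lt_le_trans.
  exact: C2_sqr_lt_t_n.
pose b0 := expR (- (l / 8)).
have ub a : 0 < a -> a <= 1 -> t_n R n < tthr a -> a < b0.
  move=> a0 a1 /(tthr_gt_ub a0 a1 tn0) /le_lt_trans; apply.
  apply: (@le_lt_trans _ _ (4 * Ct * expR (- (l / 4)))).
    by rewrite ler_pM2l; [rewrite ler_expR lerN2 ler_pM2r|exact: mulr_gt0].
  have -> : - (l / 4) = - (l / 8) + - (l / 8) by field.
  rewrite expRD mulrA gtr_pMl ?expR_gt0// expRN ltr_pdivrMr ?expR_gt0// mul1r.
  exact: lCt.
have b01 : b0 <= 1 by rewrite expR_le1 oppr_le0 divr_ge0// ltW.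
have aAb : - ln (alpha_A A n) <= M1 - M2 * ln b0.
  by rewrite /b0 expRK [leRHS](_ : _ = M1 + (1 + A) * l)// /M2; field.
pose W := s * (Kx + 4 + 4 * M1) + 4 * M2 * (s * L + 2 * Cs ^+ 2 * s).
have aA01 : 0 < alpha_A A n <= 1 by rewrite aA0 (le_trans aA2).
have hsig X := ahat_A_sum_sqr_le X mle an0 aA01 (expR_gt0 _ : 0 < b0) b01 M10 M21 M12 aAb ub s1 sn' th.
have hnull X := ahat_A_trichotomy A X as_ mle an0 a20 ana lb.
have h01 X : 0 <= ahat_A A n ahat X <= 1.
  have [/andP[h1 h2] _] := mle X; rewrite /ahat_A; case: ifP => _.
    by rewrite h2 andbT (le_trans (ltW an0)).
  by case/andP: aA01 => /ltW -> ->.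
have /andP[W0 WC] : 0 <= W <= CW M1 M2 * (s * L) by apply: signal_bound_le => //; exact: ltW.
pose z := Kz * Num.sqrt L.
have z1 : 1 <= z by rewrite -[leLHS]mulr1; apply: ler_pM.
set ap := Num.max as_ a2.
have apas : as_ <= ap by rewrite le_max lexx.
have apa2 : a2 <= ap by rewrite le_max lexx orbT.
have aplt : ap <= 2^-1 by rewrite ge_max as2.
have a2gt : 0 < a2 := lt_le_trans an0 ana.
have ap0 : 0 < ap <= 2^-1 by rewrite aplt andbT (lt_le_trans a2gt).
have snas : s / n%:R <= as_.
  rewrite /as_ ler_pM2r ?invr_gt0//.
  have : 1 * 1 <= C1 * Num.sqrt L by apply: ler_pM.
  by rewrite mul1r => h; rewrite mulrAC ler_peMl ?(ltW s0).
have tail y : z <= y -> phi y <= ap * gconv y.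
  (* The tail condition holds at l := L because [ap] >= [as_] >= s / n = exp(- L). *)
  apply: phi_le_tail => //; apply: le_trans apas; apply: le_trans snas.
  by rewrite expRN eL invf_div.
have as02 : 0 <= as_ <= 2^-1 by rewrite as0.
have aA02 : 0 <= alpha_A A n <= 2^-1 by rewrite aA2 andbT ltW.
have z10 : 0 <= 2 * Num.sqrt L by exact: mulr_ge0.
have z20 : 0 <= 2 * Num.sqrt l by exact: mulr_ge0.
have := risk_le th W0 h01 hsig hnull as02 aA02 ap0 z10 z20 z1 tail.
move=> /le_trans; apply; rewrite lee_fin /r_n -/L.
have -> : (2 * Num.sqrt L) ^+ 2 / 4 = L by rewrite exprMn sqL; field.
have -> : (2 * Num.sqrt l) ^+ 2 / 4 = l by rewrite exprMn sql; field.
have P1 : 8 * Kz / kap * (s * Num.sqrt L) <= ap * n%:R.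
  apply: (@le_trans _ _ (as_ * n%:R)); last by rewrite ler_pM2r.
  have -> : as_ * n%:R = C1 * (s * Num.sqrt L) by rewrite mulrC asn mulrA.
  by rewrite ler_wpM2r ?mulr_ge0 ?(ltW s0)// /C1 lerDr.
have P2 : C2 * l ^+ 2 <= ap * n%:R.
  by rewrite -a2n mulrC ler_pM2r.
have ex := chernoff_exponent n0 (ltW s0) sn4 L0 Ll (erefl z) P1 P2.
have -> : Crisk A M1 M2 / 2 * (2 * s * L) = Crisk A M1 M2 * (s * L) by field.
exact: (total_risk_le (M1 := M1) (M2 := M2) n0 s1 L1 enL enl A0 WC asn sqL aAn ex).
Qed.
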